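(* The group cohomology of the binary icosahedral group $\mathcal{I}$ with (trivial) integer coefficients is, for $q\ge0$, $$H^q(\mathcal{I},\mathbb{Z})\cong\begin{cases}\mathbb{Z}&\text{if }q=0,\\ \mathbb{Z}/120\mathbb{Z}&\text{if }q>0\text{ and }q\equiv0\pmod4,\\0&\text{otherwise.}\end{cases}$$
   Context: $\mathcal{I}$ is the subgroup of order 120 of the group of unit quaternions generated by $i$ and $\frac12(\varphi^{-1}+i+\varphi j)$, where $\varphi=\frac{1+\sqrt5}{2}$. *)

(* Defs.v *)
From HB Require Import structures.
From mathcomp Require Import all_boot all_order all_algebra ring_quotient ring.
From mathcomp Require Import boolp functions reals.
Set Implicit Arguments.
Unset Strict Implicit.
Unset Printing Implicit Defensive.
Import Order.TTheory GRing.Theory Num.Theory.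
Local Open Scope ring_scope.

Section Quaternions.
Variable R : realType.

(* Quat a b c d is a + b i + c j + d k. *)
Record quaternion := Quat { qre : R; qi : R; qj : R; qk : R }.

Definition quat_tuple (x : quaternion) := (qre x, qi x, qj x, qk x).
Definition tuple_quat (t : R * R * R * R) :=
  let: (a, b, c, d) := t in Quat a b c d.
Fact quat_tupleK : cancel quat_tuple tuple_quat. Proof. by case. Qed.
HB.instance Definition _ := Choice.copy quaternion (can_type quat_tupleK).

Definition qmul (x y : quaternion) : quaternion :=
  let: Quat a b c d := x in
  let: Quat a' b' c' d' := y in
  Quat (a * a' - b * b' - c * c' - d * d')
       (a * b' + b * a' + c * d' - d * c')
       (a * c' - b * d' + c * a' + d * b')
       (a * d' + b * c' - c * b' + d * a').

Definition qconj (x : quaternion) : quaternion :=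
  Quat (qre x) (- qi x) (- qj x) (- qk x).

Definition qnorm2 (x : quaternion) : R :=
  qre x ^+ 2 + qi x ^+ 2 + qj x ^+ 2 + qk x ^+ 2.

Fact qnorm2M x y : qnorm2 (qmul x y) = qnorm2 x * qnorm2 y.
Proof. by case: x y => [a b c d] [a' b' c' d']; rewrite /qnorm2 /=; ring. Qed.

Record unit_quaternion :=
  UnitQuat { uquat : quaternion; _ : qnorm2 uquat == 1 }.

HB.instance Definition _ := [isSub for uquat].
HB.instance Definition _ := [Choice of unit_quaternion by <:].

Fact uq_one_subproof : qnorm2 (Quat 1 0 0 0) == 1.
Proof. by rewrite /qnorm2 /=; apply/eqP; ring. Qed.
Fact uq_mul_subproof (x y : unit_quaternion) :
  qnorm2 (qmul (uquat x) (uquat y)) == 1.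
Proof. by rewrite qnorm2M (eqP (valP x)) (eqP (valP y)) mulr1. Qed.
Fact uq_inv_subproof (x : unit_quaternion) : qnorm2 (qconj (uquat x)) == 1.
Proof. by rewrite /qnorm2 /= !sqrrN; exact: (valP x). Qed.

Definition uq_one := UnitQuat uq_one_subproof.
Definition uq_mul x y := UnitQuat (uq_mul_subproof x y).
Definition uq_inv x := UnitQuat (uq_inv_subproof x).

Fact uq_mulA : associative uq_mul.
Proof.
move=> x y z; apply/val_inj => /=.
case: (uquat x) (uquat y) (uquat z) => [a b c d] [a' b' c' d'] [? ? ? ?] /=.
by congr Quat; ring.
Qed.
Fact uq_mul1 : left_id uq_one uq_mul.
Proof.
by move=> x; apply/val_inj => /=; case: (uquat x) => ? ? ? ?; congr Quat; ring.
Qed.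
Fact uq_mulr1 : right_id uq_one uq_mul.
Proof.
by move=> x; apply/val_inj => /=; case: (uquat x) => ? ? ? ?; congr Quat; ring.
Qed.
Fact uq_mulV : left_inverse uq_one uq_inv uq_mul.
Proof.
move=> [[a b c d] xP]; apply/val_inj => /=.
by congr Quat; rewrite -?(eqP xP) /qnorm2 /=; ring.
Qed.
Fact uq_mulrV : right_inverse uq_one uq_inv uq_mul.
Proof.
move=> [[a b c d] xP]; apply/val_inj => /=.
by congr Quat; rewrite -?(eqP xP) /qnorm2 /=; ring.
Qed.

HB.instance Definition _ :=
  isGroup.Build unit_quaternion uq_mulA uq_mul1 uq_mulr1 uq_mulV uq_mulrV.

End Quaternions.

Section GeneratedSubgroup.
Variables (G : groupType) (S : {pred G}).

Definition generated : {pred G} := fun x =>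
  `[< forall H : {pred G}, group_closed H -> {subset S <= H} -> x \in H >].

Record generated_group := GeneratedElt { gval : G; _ : gval \in generated }.

HB.instance Definition _ := [isSub for gval].
HB.instance Definition _ := [Choice of generated_group by <:].

Fact generated_group_closed : group_closed generated.
Proof.
split=> [|x y /asboolP xS /asboolP yS].
  by apply/asboolP => H [].
apply/asboolP => H gH sSH; have [_ divH] := gH.
by apply: divH; [exact: xS | exact: yS].
Qed.
HB.instance Definition _ :=
  SubChoice_isSubGroup.Build G generated generated_group generated_group_closed.

End GeneratedSubgroup.

Section BinaryIcosahedral.
Variable R : realType.

Definition phi : R := (1 + Num.sqrt 5) / 2.

Fact phi2 : phi ^+ 2 = phi + 1.
Proof.
have s5 : Num.sqrt 5 ^+ 2 = 5 :> R by rewrite sqr_sqrtr // ler0n.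
by rewrite /phi; move: (Num.sqrt _) s5 => s s5; field: s5.
Qed.

Fact phi_neq0 : phi != 0.
Proof.
apply/eqP => p0; have := phi2.
by rewrite p0 expr0n /= add0r => /esym/eqP; rewrite oner_eq0.
Qed.

Fact uq_i_subproof : qnorm2 (Quat 0 1 0 0 : quaternion R) == 1.
Proof. by rewrite /qnorm2 /=; apply/eqP; ring. Qed.
Definition uq_i : unit_quaternion R := UnitQuat uq_i_subproof.

Fact uq_omega_subproof : qnorm2 (Quat (phi^-1 / 2) (1 / 2) (phi / 2) 0) == 1.
Proof.
have -> : phi^-1 = phi - 1.
  apply: (mulfI phi_neq0); rewrite divff ?phi_neq0 //.
  by rewrite mulrBr mulr1 -expr2 phi2; ring.
rewrite /qnorm2 /=; apply/eqP; move: phi phi2 => p p2.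
have -> : (p - 1) / 2 = p / 2 - 1 / 2 :> R by rewrite mulrBl.
have -> : (p / 2 - 1 / 2) ^+ 2 + (1 / 2) ^+ 2 + (p / 2) ^+ 2 + 0 ^+ 2
          = (p ^+ 2 - p + 1) / 2 :> R by field.
by rewrite p2; field.
Qed.
Definition uq_omega : unit_quaternion R := UnitQuat uq_omega_subproof.

Definition binary_icosahedral := generated_group [in [:: uq_i; uq_omega]].

HB.instance Definition _ := Group.on binary_icosahedral.

End BinaryIcosahedral.

Record gmodule (G : groupType) := GModule {
  gmodule_sort :> zmodType;
  gact : G -> {additive gmodule_sort -> gmodule_sort};
  _ : forall m, gact 1%g m = m;
  _ : forall g h m, gact (g * h)%g m = gact g (gact h m)
}.

Definition trivial_gmodule (G : groupType) (A : zmodType) : gmodule G :=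
  @GModule G A (fun=> idfun) (fun=> erefl) (fun _ _ _ => erefl).

Section GroupCohomology.
Variables (G : groupType) (M : gmodule G).

(* Inhomogeneous (bar) cochains. *)
Definition cochain (q : nat) : Type := ('I_q -> G) -> M.
HB.instance Definition _ q := GRing.Zmodule.on (cochain q).

(* (g_0, ..., g_q) |-> (g_0, ..., g_j g_{j+1}, ..., g_q) *)
Definition contract q (j : 'I_q) (g : 'I_q.+1 -> G) : 'I_q -> G := fun i =>
  if (i < j)%N then g (widen_ord (leqnSn q) i)
  else if i == j then (g (widen_ord (leqnSn q) i) * g (lift ord0 i))%g
  else g (lift ord0 i).

Definition coboundary q (f : cochain q) : cochain q.+1 := fun g =>
  gact M (g ord0) (f (fun i => g (lift ord0 i)))
  + \sum_(j < q) f (contract j g) *~ (-1) ^+ j.+1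
  + f (fun i => g (widen_ord (leqnSn q) i)) *~ (-1) ^+ q.+1.

Fact coboundary_is_zmod_morphism q : zmod_morphism (@coboundary q).
Proof.
move=> f f'; apply/funext => g; rewrite /coboundary.
have E p (u v : cochain p) h : (u - v) h = u h - v h by [].
rewrite !E raddfB mulrzBl; under eq_bigr do rewrite E mulrzBl.
by rewrite sumrB !opprD (addrACA (gact M _ _)) [LHS]addrACA.
Qed.
HB.instance Definition _ q :=
  GRing.isZmodMorphism.Build (cochain q) (cochain q.+1) (@coboundary q)
    (@coboundary_is_zmod_morphism q).

Definition is_cocycle q : {pred cochain q} := fun f => coboundary f == 0.

Definition is_coboundary q : {pred cochain q} :=
  match q with
  | 0 => fun f => f == 0
  | p.+1 => fun f => `[< exists c : cochain p, f = coboundary c >]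
  end.

Record cocycle q :=
  Cocycle { cocycle_val : cochain q; _ : cocycle_val \in @is_cocycle q }.

HB.instance Definition _ q := [isSub for @cocycle_val q].
HB.instance Definition _ q := [Choice of cocycle q by <:].

Fact is_cocycle_zmod_closed q : zmod_closed (@is_cocycle q).
Proof.
split=> [|f f' /eqP df /eqP df']; apply/eqP; first exact: raddf0.
by rewrite raddfB /= df df' subrr.
Qed.
HB.instance Definition _ q :=
  GRing.SubChoice_isSubZmodule.Build (cochain q) (@is_cocycle q) (cocycle q)
    (@is_cocycle_zmod_closed q).

Definition coboundaries q : {pred cocycle q} :=
  fun z => val z \in @is_coboundary q.

Fact coboundaries_zmod_closed q : zmod_closed (@coboundaries q).
Proof.
case: q => [|q]; split.
- by apply/eqP; rewrite raddf0.
- by move=> z z' /eqP z0 /eqP z0'; apply/eqP; rewrite raddfB /= z0 z0' subrr.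
- by apply/asboolP; exists 0; rewrite !raddf0.
- move=> z z' /asboolP [c zc] /asboolP [c' zc'].
  by apply/asboolP; exists (c - c'); rewrite !raddfB /= zc zc'.
Qed.
HB.instance Definition _ q :=
  GRing.isZmodClosed.Build (cocycle q) (@coboundaries q)
    (@coboundaries_zmod_closed q).

Definition cohomology (q : nat) : zmodType := Quotient.quot (@coboundaries q).

End GroupCohomology.

Arguments cohomology : clear implicits.

Definition zmod_isomorphic (U V : zmodType) : Prop :=
  exists f : {additive U -> V}, bijective f.

(* Main.v *)
Require Import Defs.
From HB Require Import structures.
From mathcomp Require Import all_boot all_order all_algebra.
From mathcomp Require Import generic_quotient ring_quotient ring zify.
From mathcomp Require Import boolp functions reals.

(** The binary icosahedral group [G] acts freely on the 3-sphere, which is why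
    its cohomology has period 4; the proof makes this explicit.  Put
    [s = i / omega] and [t = - omega].  They generate [G] and satisfy
    [s s = t s t] and [t t t t = s t s], and the two relators are tied by the
    single identity [(1 - s) R1 + (1 - t) R2 = 0] between Fox derivatives.  On
    functions on [G] this gives a complex of [G]-modules
[[
      0 -> int -> (G -> int) -d0-> (G -> int * int) -d1-> (G -> int * int)
               -d2-> (G -> int) -sum-> int -> 0
]]
    which is the cellular cochain complex of a decomposition of the sphere: one
    orbit of vertices, two of edges (labelled [s] and [t]), two of faces (the
    relators), one of solid cells.

    The four middle terms are coinduced, hence acyclic, by an explicit
    contraction of the inhomogeneous cochains ([contractionP]).  Cutting an
    exact complex into short exact sequences, [dimension_shift] gives
    H^(q+4)(G, int) = H^q(G, int) for positive q, and the connecting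
    homomorphisms starting in degree 0 ([H1_eq0], [cohomology_iso]) identify
    H^1, ..., H^4 with the successive homology groups of the complex of
    invariants, which has the terms int, int^2, int^2, int, int.  There the
    first map is zero, the second has determinant -1 because [G] is perfect,
    the third is zero, and the last is multiplication by the order 120
    ([cohomology_period4]).

    Exactness is the geometric input.  At the two ends it says that [s] and [t]
    generate [G] ([d0_eq0], [d2_onto]).  At [d1] it says that the 2-complex of
    the presentation is simply connected, i.e. that the relations present [G]:
    starting from a spanning tree of the Cayley graph, each relator propagates
    the vanishing of a closed cochain to the last edge of a face from all its
    other edges, until the 240 edges are reached, a finite verification in the
    style of Todd and Coxeter ([saturates_sound], [icosians_saturate]).  It holds with values in any ring
    and modulo any subgroup.  At [d2] exactness then follows over the rationals
    by counting dimensions ([exact2_rat]), the Euler characteristic of the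
    3-sphere being 0, and descends to the integers because exactness at [d1]
    modulo m makes the image of [d1] a pure subgroup ([exact2]).

    The Cayley graph itself is computed in the order with basis 1, s, t, st over
    Z[psi], where [psi = 1 - phi] is the conjugate golden ratio; since [psi] is
    irrational, these exact coordinates tell the 120 elements apart
    ([realize_inj], [elt_inj], [elt_surj]). *)

Set Implicit Arguments.
Unset Strict Implicit.
Unset Printing Implicit Defensive.
Import Order.TTheory GRing.Theory Num.Theory.
Local Open Scope ring_scope.

(** * Quotients of abelian groups *)
Section Quotients.
Local Open Scope quotient_scope.

Lemma zmod_isomorphic_trans (U V W : zmodType) :
  zmod_isomorphic U V -> zmod_isomorphic V W -> zmod_isomorphic U W.
Proof.
move=> [f fB] [g gB]; exists (g \o f : {additive U -> W}).
exact: bij_comp.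
Qed.

Variables (U : zmodType) (I : zmodClosed U).
Local Notation Q := (Quotient.quot I).

Lemma quot_eq0 z : (\pi_Q z == 0) = (z \in I).
Proof. by rewrite -(raddf0 \pi_Q) -Quotient.idealrBE subr0. Qed.

Lemma quot_surj (x : Q) : exists z, \pi_Q z = x.
Proof. by exists (repr x); rewrite reprK. Qed.

Lemma first_isomorphism (W : zmodType) (f : {additive U -> W}) :
    (forall z, (f z == 0) = (z \in I)) -> (forall w, exists z, f z = w) ->
  zmod_isomorphic Q W.
Proof.
move=> ker_f surj_f.
have f_repr z : f (repr (\pi_Q z)) = f z.
  by apply/eqP; rewrite -subr_eq0 -raddfB ker_f Quotient.idealrBE reprK.
have barf_zmod : zmod_morphism (f \o repr : Q -> W).
  move=> x y; rewrite -[x]reprK -[y]reprK -raddfB /= !f_repr.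
  by rewrite raddfB.
pose aM := GRing.isZmodMorphism.Build _ _ _ barf_zmod.
pose barf : {additive Q -> W} := HB.pack (f \o repr : _ -> _) aM.
have [g gK] := choice surj_f.
exists barf; exists (\pi_Q \o g) => [x|w] /=; last by rewrite f_repr.
apply/eqP; rewrite -[x in _ == x]reprK -Quotient.idealrBE -ker_f raddfB.
by rewrite gK subrr.
Qed.

End Quotients.

(** * Coinduced modules and the contraction of their cochains *)
Section Coinduced.
Variables (G : groupType) (V : zmodType).

Definition translate (g : G) (f : G -> V) : G -> V := fun x => f (g^-1 * x)%g.

Fact translate_zmod_morphism g : zmod_morphism (translate g).
Proof. by []. Qed.
HB.instance Definition _ g :=
  GRing.isZmodMorphism.Build (G -> V) (G -> V) (translate g)
    (translate_zmod_morphism g).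

Fact translate1 f : translate 1%g f = f.
Proof. by apply/funext => x; rewrite /translate invg1 mul1g. Qed.
Fact translateM g h f : translate (g * h)%g f = translate g (translate h f).
Proof. by apply/funext => x; rewrite /translate invgM mulgA. Qed.

Definition coinduced : gmodule G :=
  GModule (gact := fun g => translate g) translate1 translateM.

End Coinduced.

Definition equivariant (G : groupType) (M N : gmodule G) (f : M -> N) :=
  forall g m, f (gact M g m) = gact N g (f m).

Section CochainMaps.
Variables (G : groupType) (M N : gmodule G) (f : {additive M -> N}).
Hypothesis f_equivariant : equivariant f.

Lemma coboundary_comp q (c : cochain M q) :
  coboundary (f \o c : cochain N q) = f \o coboundary c.
Proof.
apply/funext => g; rewrite /coboundary /= !raddfD raddf_sum /=.
congr (_ + _ + _); [by rewrite f_equivariant | | by rewrite raddfMz].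
by apply: eq_bigr => j _; rewrite raddfMz.
Qed.

End CochainMaps.

Section Tuples.
Variable G : groupType.

Definition cons_tuple q (y : G) (g : 'I_q -> G) : 'I_q.+1 -> G :=
  fun i => if unlift ord0 i is Some j then g j else y.

Lemma cons_tuple0 q y (g : 'I_q -> G) : cons_tuple y g ord0 = y.
Proof. by rewrite /cons_tuple unlift_none. Qed.

Lemma cons_tuple_lift q y (g : 'I_q -> G) i : cons_tuple y g (lift ord0 i) = g i.
Proof. by rewrite /cons_tuple liftK. Qed.

Lemma ord0_tupleP (g h : 'I_0 -> G) : g = h.
Proof. by apply/funext => -[]. Qed.

Lemma widen_ord_lift0 q (i : 'I_q) :
  widen_ord (leqnSn q.+1) (lift ord0 i) = lift ord0 (widen_ord (leqnSn q) i).
Proof. exact/val_inj. Qed.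

Lemma widen_ord0 q : widen_ord (leqnSn q.+1) ord0 = ord0.
Proof. exact/val_inj. Qed.

Lemma widen_cons_tuple q y (g : 'I_q.+1 -> G) :
  (fun i => cons_tuple y g (widen_ord (leqnSn q.+1) i))
  = cons_tuple y (fun i => g (widen_ord (leqnSn q) i)).
Proof.
apply/funext => i; case: (unliftP ord0 i) => [j ->|->].
  by rewrite widen_ord_lift0 !cons_tuple_lift.
by rewrite widen_ord0 !cons_tuple0.
Qed.

Lemma contract_cons_tuple0 q y (g : 'I_q.+1 -> G) :
  contract ord0 (cons_tuple y g)
  = cons_tuple (y * g ord0)%g (fun i => g (lift ord0 i)).
Proof.
apply/funext => i; rewrite /contract ltn0.
case: (unliftP ord0 i) => [j ->|->].
  by rewrite eq_sym (negPf (neq_lift _ _)) !cons_tuple_lift.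
by rewrite eqxx widen_ord0 !cons_tuple0 cons_tuple_lift.
Qed.

Lemma contract_cons_tuple_lift q y (g : 'I_q.+1 -> G) (j : 'I_q) :
  contract (lift ord0 j) (cons_tuple y g) = cons_tuple y (contract j g).
Proof.
apply/funext => i; case: (unliftP ord0 i) => [k ->|->].
  rewrite cons_tuple_lift /contract widen_ord_lift0 !cons_tuple_lift.
  by rewrite (inj_eq lift_inj) /= /bump /= !add1n ltnS.
by rewrite /contract /= widen_ord0 !cons_tuple0.
Qed.

Lemma cons_tuple_eta q (g : 'I_q.+1 -> G) :
  cons_tuple (g ord0) (fun i => g (lift ord0 i)) = g.
Proof.
apply/funext => i; case: (unliftP ord0 i) => [j ->|->].
  by rewrite cons_tuple_lift.
by rewrite cons_tuple0.
Qed.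

End Tuples.

Section Contraction.
Variables (G : groupType) (V : zmodType).
Local Notation C := (coinduced G V).

(** The contracting homotopy of the acyclic complex of a coinduced module: the
    function argument [x] is moved into the first slot of the cochain.  The
    inverse turns the left translation action into multiplication of that
    slot by the next argument. *)
Definition contraction q (c : cochain C q.+1) : cochain C q :=
  fun g x => c (cons_tuple x^-1%g g) 1%g.

Lemma coinduced_coboundaryE q (c : cochain C q) g x :
  coboundary c g x = c (fun i => g (lift ord0 i)) ((g ord0)^-1 * x)%g
    + \sum_(j < q) c (contract j g) x *~ (-1) ^+ j.+1
    + c (fun i => g (widen_ord (leqnSn q) i)) x *~ (-1) ^+ q.+1.
Proof.
have ev_zmod : zmod_morphism (fun f : G -> V => f x) by [].
pose evM := GRing.isZmodMorphism.Build _ _ _ ev_zmod.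
pose ev : {additive (G -> V) -> V} := HB.pack (fun f : G -> V => f x) evM.
rewrite /coboundary -[LHS]/(ev _) !raddfD raddf_sum raddfMz.
by congr (_ + _ + _); apply: eq_bigr => j _; rewrite raddfMz.
Qed.

(** In [coboundary c] at [(x^-1, g)] the action term gives back [c g x]; every
    other term occurs one slot earlier, with the opposite sign, in
    [coboundary (contraction c)]. *)
Lemma contractionP q (c : cochain C q.+1) :
  coboundary (contraction c) + contraction (coboundary c) = c.
Proof.
apply/funext => g; apply/funext => x.
have -> : (coboundary (contraction c) + contraction (coboundary c)) g x
  = coboundary (contraction c) g x + coboundary c (cons_tuple x^-1%g g) 1%g.
  by [].
rewrite !coinduced_coboundaryE /contraction big_ord_recl.
rewrite contract_cons_tuple0 widen_cons_tuple cons_tuple0 invgK mulg1.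
rewrite invgM invgK expr1 mulrN1z [_ ^+ q.+2]exprS mulN1r mulrNz.
have -> : (fun i => cons_tuple x^-1%g g (lift ord0 i)) = g.
  by apply/funext => i; rewrite cons_tuple_lift.
have -> : \sum_(i < q) c (contract (lift ord0 i) (cons_tuple x^-1%g g)) 1%g
              *~ (-1) ^+ (lift ord0 i).+1
        = - \sum_(i < q) c (cons_tuple x^-1%g (contract i g)) 1%g
              *~ (-1) ^+ i.+1.
  rewrite -sumrN; apply: eq_bigr => i _.
  by rewrite contract_cons_tuple_lift lift0 exprS mulN1r mulrNz.
by rewrite -opprD -[X in _ + X]addrA -opprD addrCA subrr addr0.
Qed.

(** In degree 0 the homotopy only recovers a cochain up to a constant: the
    invariants of a coinduced module are the one group not killed. *)
Lemma contraction0P (c : cochain C 0) (g : 'I_0 -> G) :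
  contraction (coboundary c) g = c g - cst (c g 1%g).
Proof.
apply/funext => x; rewrite [LHS]coinduced_coboundaryE big_ord0 addr0.
rewrite cons_tuple0 invgK mulg1 expr1 mulrN1z.
by congr (c _ _ - c _ _); apply: ord0_tupleP.
Qed.

Lemma contraction_coboundary q (c : cochain C q.+1) :
  contraction (coboundary c) = c - coboundary (contraction c).
Proof. by rewrite -[X in X - _]contractionP [X in X - _]addrC addrK. Qed.

Lemma coboundary_cst (v : cochain C 0) (w : V) :
  (forall g, v g = cst w) -> coboundary v = 0.
Proof.
move=> vw; apply/funext => g; apply/funext => x.
by rewrite coinduced_coboundaryE big_ord0 addr0 !vw expr1 mulrN1z subrr.
Qed.

End Contraction.

(** * The square of the coboundary vanishes *)
Section CoboundarySquare.
Variables (G : groupType) (M : gmodule G).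

(** The unit of coinduction.  It embeds every module into a coinduced one, in
    which evaluation at 1 gives back [m]. *)
Definition orbit_map (m : M) : coinduced G M := fun x => gact M x^-1%g m.

Fact orbit_map_zmod_morphism : zmod_morphism orbit_map.
Proof. by move=> m n; apply/funext => x; rewrite /orbit_map raddfB. Qed.
HB.instance Definition _ :=
  GRing.isZmodMorphism.Build M (coinduced G M) orbit_map
    orbit_map_zmod_morphism.

Lemma gactM g h m : gact M (g * h)%g m = gact M g (gact M h m).
Proof. by case: M m. Qed.

Lemma gact1 m : gact M 1%g m = m.
Proof. by case: M m. Qed.

Lemma orbit_map_equivariant : equivariant orbit_map.
Proof.
move=> g m; apply/funext => x.
by rewrite /orbit_map /= /translate invgM invgK gactM.
Qed.

End CoboundarySquare.

(** A cochain with values in a coinduced module is not determined by its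
    contraction, which only sees values at 1; one coming from [M] through
    [orbit_map] is.  So it suffices to treat contractions of squares. *)
Lemma coboundaryK_coinduced (G : groupType) (M : gmodule G) q :
    (forall c : cochain (coinduced G M) q,
       contraction (coboundary (coboundary c)) = 0) ->
  forall c : cochain M q, coboundary (coboundary c) = 0.
Proof.
move=> S0 c; apply/funext => g.
have /(congr1 (fun f => f (fun i => g (lift ord0 i)) (g ord0)^-1%g)) :=
  S0 (@orbit_map G M \o c).
rewrite !(coboundary_comp (@orbit_map_equivariant G M)) /contraction /=.
by rewrite /orbit_map invg1 gact1 invgK cons_tuple_eta.
Qed.

(** The homotopy formula makes the usual double sum unnecessary: it expresses
    the contraction of the square of the coboundary of [c] as the square of the
    coboundary of [contraction c], which has degree one less; in degree 0 the
    coboundary of a constant is left over. *)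
Lemma coboundaryK (G : groupType) (M : gmodule G) q (c : cochain M q) :
  coboundary (coboundary c) = 0.
Proof.
elim: q M c => [|q IHq] M; apply: coboundaryK_coinduced => c.
- have -> : contraction (coboundary (coboundary c))
            = coboundary (fun g => cst (c g 1%g) : coinduced G M).
    rewrite contraction_coboundary -raddfB /=; congr coboundary; apply/funext => g.
    have -> : (c - contraction (coboundary c)) g
              = c g - contraction (coboundary c) g by [].
    by rewrite contraction0P opprB addrC subrK.
  pose g0 (i : 'I_0) : G := 1%g.
  apply: (@coboundary_cst _ _ _ (c g0 1%g)) => g.
  by rewrite (ord0_tupleP g g0).
- by rewrite !contraction_coboundary raddfB /= IHq subr0 subrr.
Qed.

Lemma coboundary_contraction (G : groupType) (V : zmodType) q
    (c : cochain (coinduced G V) q) :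
  coboundary (contraction (coboundary c)) = coboundary c.
Proof. by rewrite -[RHS]contractionP coboundaryK addr0. Qed.

Lemma cocycleP (G : groupType) (M : gmodule G) q (z : cocycle M q) :
  coboundary (val z) = 0.
Proof. exact/eqP/(valP z). Qed.

(** * Kernels and the connecting homomorphism *)
Section Kernel.
Variables (G : groupType) (M N : gmodule G) (f : {additive M -> N}).
Hypothesis f_equivariant : equivariant f.

Definition in_kernel : {pred M} := fun m => f m == 0.

Record kernel_type := KernelElt { kernel_val : M; _ : kernel_val \in in_kernel }.
HB.instance Definition _ := [isSub for kernel_val].
HB.instance Definition _ := [Choice of kernel_type by <:].

Fact in_kernel_zmod_closed : zmod_closed in_kernel.
Proof.
split=> [|m n /eqP fm /eqP fn]; apply/eqP; first exact: raddf0.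
by rewrite raddfB fm fn subrr.
Qed.
HB.instance Definition _ :=
  GRing.SubChoice_isSubZmodule.Build M in_kernel kernel_type
    in_kernel_zmod_closed.

Fact kernel_act_subproof g (k : kernel_type) : gact M g (val k) \in in_kernel.
Proof. by apply/eqP; rewrite f_equivariant (eqP (valP k)) raddf0. Qed.
Definition kernel_act g (k : kernel_type) := KernelElt (kernel_act_subproof g k).

Fact kernel_act_zmod_morphism g : zmod_morphism (kernel_act g).
Proof. by move=> k l; apply/val_inj; rewrite /= !raddfB. Qed.
HB.instance Definition _ g :=
  GRing.isZmodMorphism.Build kernel_type kernel_type (kernel_act g)
    (kernel_act_zmod_morphism g).

Fact kernel_act1 k : kernel_act 1%g k = k.
Proof. by apply/val_inj; rewrite /= gact1. Qed.
Fact kernel_actM g h k : kernel_act (g * h)%g k = kernel_act g (kernel_act h k).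
Proof. by apply/val_inj; rewrite /= gactM. Qed.

Definition kernel : gmodule G :=
  GModule (gact := fun g => kernel_act g) kernel_act1 kernel_actM.

Variables (L : gmodule G) (e : {additive L -> M}).
Hypothesis e_equivariant : equivariant e.
Hypothesis fe0 : forall l, f (e l) = 0.

Fact corestrict_subproof l : e l \in in_kernel.
Proof. by rewrite unfold_in fe0. Qed.
Definition corestrict l : kernel := KernelElt (corestrict_subproof l).

Fact corestrict_zmod_morphism : zmod_morphism corestrict.
Proof. by move=> l l'; apply/val_inj; rewrite /= raddfB. Qed.
HB.instance Definition _ :=
  GRing.isZmodMorphism.Build L kernel corestrict corestrict_zmod_morphism.

Lemma corestrict_equivariant : equivariant corestrict.
Proof. by move=> g l; apply/val_inj => /=; apply: e_equivariant. Qed.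

End Kernel.

Section Connecting.
Local Open Scope quotient_scope.
Variables (G : groupType) (V : zmodType) (A B : gmodule G).
Local Notation C := (coinduced G V).
Variables (i : {additive A -> C}) (p : {additive C -> B}).
Hypotheses (i_equivariant : equivariant i) (p_equivariant : equivariant p).
Hypotheses (i_inj : injective i) (p_surj : forall b, exists c, p c = b).
Hypotheses (pi0 : forall a, p (i a) = 0).
Hypothesis (exactC : forall c, p c = 0 -> exists a, i a = c).

(** The snake construction, additive because the preimage under the coboundary
    is taken with [contraction] instead of being chosen. *)
Definition connect q (z : cochain A q.+1) : cochain B q :=
  p \o contraction (i \o z : cochain C q.+1).

Lemma coboundary_contraction_cocycle q (z : cocycle A q.+1) :
  coboundary (contraction (i \o val z : cochain C q.+1)) = i \o val z.
Proof.
rewrite -[RHS](contractionP (i \o val z : cochain C q.+1)).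
rewrite (coboundary_comp i_equivariant) cocycleP.
have -> : i \o (0 : cochain A q.+2) = 0 :> cochain C q.+2.
  by apply/funext => g; apply: raddf0.
by rewrite [X in _ + X](_ : _ = 0) ?addr0.
Qed.

Fact connecting_subproof q (z : cocycle A q.+1) :
  connect (val z) \in @is_cocycle G B q.
Proof.
apply/eqP; rewrite /connect (coboundary_comp p_equivariant).
by rewrite coboundary_contraction_cocycle; apply/funext => g /=; apply: pi0.
Qed.
Definition connecting q (z : cocycle A q.+1) : cocycle B q :=
  Cocycle (connecting_subproof z).

Fact connecting_zmod_morphism q : zmod_morphism (@connecting q).
Proof.
move=> z z'; apply/val_inj; apply/funext => g.
rewrite -[RHS]/(connect (val z) g - connect (val z') g) /connect /= -raddfB.
congr (p _); apply/funext => x.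
exact: (congr1 (fun f => f 1%g) (raddfB i _ _)).
Qed.
HB.instance Definition _ q :=
  GRing.isZmodMorphism.Build (cocycle A q.+1) (cocycle B q) (@connecting q)
    (@connecting_zmod_morphism q).

(** The cocycles of [B] that die under the connecting homomorphism.  For
    positive degree these are the coboundaries ([lifts_coboundary]), as [C] is
    acyclic; in degree 0 they are the images of constants ([lifts0]).  Stating
    exactness with this subgroup treats both cases at once. *)
Definition lifts q (w : cocycle B q) : Prop :=
  exists2 c : cochain C q, coboundary c = 0 & val w = p \o c.

(** Exactness at the cohomology of [A]: if [connecting z] is the image of the
    cocycle [c], then [contraction (i z) - c] comes from a cochain of [A] whose
    coboundary is [z]. *)
Lemma connecting_coboundary q (z : cocycle A q.+1) :
  lifts (connecting z) <-> z \in @coboundaries G A q.+1.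
Proof.
split=> [[c dc0 zc]|/asboolP[a za]]; last first.
  exists (contraction (coboundary (i \o a : cochain C q)) - (i \o a)).
    by rewrite raddfB /= coboundary_contraction subrr.
  rewrite /= /connect za -(coboundary_comp i_equivariant).
  apply/funext => g /=.
  have -> (u v : cochain C q) : (u - v) g = u g - v g by [].
  by rewrite raddfB pi0 subr0.
have [a ia] : exists a : cochain A q,
    i \o a = contraction (i \o val z : cochain C q.+1) - c.
  suff /choice[a aP] g : exists a,
      i a = (contraction (i \o val z : cochain C q.+1) - c) g.
    by exists a; apply/funext => g; apply: aP.
  apply: exactC.
  have -> (u v : cochain C q) : (u - v) g = u g - v g by [].
  rewrite raddfB; apply/eqP; rewrite subr_eq0; apply/eqP.
  exact: (congr1 (fun f => f g) zc).
apply/asboolP; exists a; apply/funext => g; apply: i_inj.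
have := congr1 (fun f => f g) (coboundary_contraction_cocycle z).
rewrite /= => <-.
rewrite -[RHS]/((i \o coboundary a) g) -(coboundary_comp i_equivariant) ia.
by rewrite raddfB /= dc0 subr0.
Qed.

(** The usual diagram chase: lift [w] to [c]; then [coboundary c] comes from
    [A], and [c] differs from its re-contraction by a cocycle of [C]. *)
Lemma connecting_surjective q (w : cocycle B q) :
  exists z, lifts (w - connecting z).
Proof.
have [c wc] : exists c : cochain C q, val w = p \o c.
  have /choice[c cP] g : exists c, p c = val w g by apply: p_surj.
  by exists c; apply/funext => g; rewrite /= cP.
have [a ia] : exists a : cochain A q.+1, i \o a = coboundary c.
  suff /choice[a aP] g : exists a, i a = coboundary c g.
    by exists a; apply/funext => g; apply: aP.
  apply: exactC; rewrite -[LHS]/((p \o coboundary c) g).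
  by rewrite -(coboundary_comp p_equivariant) -wc cocycleP.
have a_cocycle : a \in @is_cocycle G A q.+1.
  apply/eqP/funext => g; apply: i_inj; rewrite raddf0.
  rewrite -[LHS]/((i \o coboundary a) g) -(coboundary_comp i_equivariant) ia.
  by rewrite coboundaryK.
exists (Cocycle a_cocycle); exists (c - contraction (coboundary c)).
  by rewrite raddfB /= coboundary_contraction subrr.
apply/funext => g; rewrite -[LHS]/(val w g - connect a g) wc /connect ia /=.
by rewrite -raddfB.
Qed.

Lemma cohomology_iso q (W : zmodType) (h : {additive cocycle B q -> W}) :
    (forall w, h w = 0 <-> lifts w) -> (forall u, exists w, h w = u) ->
  zmod_isomorphic (cohomology G A q.+1) W.
Proof.
move=> ker_h surj_h.
apply: (@first_isomorphism _ (@coboundaries G A q.+1) W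
         (h \o @connecting q : {additive _ -> _})) => [z|u].
  apply/eqP/idP => /= [/ker_h|] /connecting_coboundary; first by [].
  by move/ker_h.
have [w <-] := surj_h u; have [z /ker_h] := connecting_surjective w.
by rewrite raddfB => /eqP; rewrite subr_eq0 => /eqP ->; exists z.
Qed.

Lemma lifts_coboundary q (w : cocycle B q.+1) :
  lifts w <-> w \in @coboundaries G B q.+1.
Proof.
split=> [[c dc wc]|/asboolP[b wb]].
  apply/asboolP; exists (p \o contraction c).
  rewrite wc (coboundary_comp p_equivariant).
  by rewrite -[in LHS](contractionP c) dc [X in _ + X](_ : _ = 0) ?addr0.
have /choice[c cP] g : exists c, p c = b g by apply: p_surj.
exists (coboundary (c : cochain C q)); first exact: coboundaryK.
rewrite -(coboundary_comp p_equivariant) wb; congr coboundary.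
by apply/funext => g; rewrite /= cP.
Qed.

Lemma dimension_shift q :
  zmod_isomorphic (cohomology G A q.+2) (cohomology G B q.+1).
Proof.
pose Q := cohomology G B q.+1.
apply: (@cohomology_iso _ Q (\pi_Q : {additive _ -> _})) => [w|x].
  rewrite lifts_coboundary -(quot_eq0 (@coboundaries G B q.+1)).
  by split=> [->|/eqP].
exact: (@quot_surj _ (@coboundaries G B q.+1)).
Qed.

Lemma lifts0 (w : cocycle B 0) :
  lifts w <-> exists v, forall g, val w g = p (cst v).
Proof.
split=> [[c dc ->]|[v wv]].
  pose g0 (j : 'I_0) : G := 1%g.
  exists (c g0 1%g) => g; rewrite /= (ord0_tupleP g g0); congr (p _).
  have := contraction0P c g0; rewrite dc => /esym/eqP.
  by rewrite [X in _ == X](_ : _ = 0) // subr_eq0 => /eqP.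
exists (fun=> cst v); first exact: coboundary_cst.
by apply/funext => g; rewrite wv.
Qed.

Definition fixed_by_group (b : B) := forall g, gact B g b = b.

Lemma cocycle0_fixed (w : cocycle B 0) g : fixed_by_group (val w g).
Proof.
move=> y; have /(congr1 (fun f => f (cons_tuple y g))) := cocycleP w.
rewrite /coboundary big_ord0 addr0 expr1 mulrN1z cons_tuple0.
rewrite [X in _ (val w X)](ord0_tupleP _ g) [X in _ - val w X](ord0_tupleP _ g).
by move/eqP; rewrite subr_eq0 => /eqP.
Qed.

Lemma H1_eq0 :
  (forall b, fixed_by_group b -> exists v, b = p (cst v)) ->
  forall x : cohomology G A 1, x = 0.
Proof.
move=> inv x; have [z <-] := @quot_surj _ (@coboundaries G A 1) x.
apply/eqP; rewrite quot_eq0; apply/connecting_coboundary/lifts0.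
pose g0 (j : 'I_0) : G := 1%g; set w := connecting _.
have [v wv] := inv _ (@cocycle0_fixed w g0).
by exists v => g; rewrite (ord0_tupleP g g0).
Qed.

End Connecting.

(** The case of two consecutive kernels in a complex [C -> N -> P] exact at
    [N]: there [0 -> ker f -> C -> ker g -> 0] is short exact. *)
Section KernelShift.
Variables (G : groupType) (V : zmodType) (N P : gmodule G).
Local Notation C := (coinduced G V).
Variables (f : {additive C -> N}) (g : {additive N -> P}).
Hypotheses (f_equivariant : equivariant f) (g_equivariant : equivariant g).
Hypothesis (gf0 : forall c, g (f c) = 0).
Hypothesis (exactN : forall m, g m = 0 -> exists c, f c = m).
Local Notation A := (kernel f_equivariant).
Local Notation B := (kernel g_equivariant).

Let i : {additive A -> C} := val.
Let p : {additive C -> B} := corestrict g_equivariant gf0.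

Let p_equivariant : equivariant p.
Proof. exact: corestrict_equivariant f_equivariant _. Qed.

Let p_surj b : exists c, p c = b.
Proof.
have [c fc] := exactN (eqP (valP b)).
by exists c; apply/val_inj.
Qed.

Let pi0 a : p (i a) = 0.
Proof. by apply/val_inj; apply/eqP/(valP a). Qed.

Let exactC c : p c = 0 -> exists a, i a = c.
Proof.
move=> /(congr1 val) pc; have cK : c \in in_kernel f by apply/eqP.
by exists (KernelElt cK).
Qed.

Lemma kernel_shift q :
  zmod_isomorphic (cohomology G A q.+2) (cohomology G B q.+1).
Proof.
by apply: (dimension_shift (i := i) _ p_equivariant val_inj p_surj pi0 exactC).
Qed.

Lemma kernel_H1_eq0 :
    (forall m, g m = 0 -> fixed_by_group m -> exists v, m = f (cst v)) ->
  forall x : cohomology G A 1, x = 0.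
Proof.
move=> inv; apply: (H1_eq0 (i := i) _ p_equivariant val_inj pi0 exactC).
  by [].
move=> b b_inv; have [||v bv] := inv (val b); first exact/eqP/(valP b).
  by move=> y; have /(congr1 val) := b_inv y.
by exists v; apply/val_inj.
Qed.

End KernelShift.

Lemma cohomology0_trivial (G : groupType) (U : zmodType) :
  zmod_isomorphic (cohomology G (trivial_gmodule G U) 0) U.
Proof.
pose M := trivial_gmodule G U; pose g0 (i : 'I_0) : G := 1%g.
have ev_zmod : zmod_morphism (fun z : cocycle M 0 => val z g0 : U) by [].
pose evM := GRing.isZmodMorphism.Build _ _ _ ev_zmod.
pose ev : {additive cocycle M 0 -> U} :=
  HB.pack (fun z : cocycle M 0 => val z g0 : U) evM.
apply: (@first_isomorphism _ (@coboundaries G M 0) U ev) => [z|u].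
  apply/eqP/eqP => [z0|/(congr1 (fun f => f g0))//].
  by apply/funext => g; rewrite (ord0_tupleP g g0) [LHS]z0.
have uP : (fun=> u) \in @is_cocycle G M 0.
  by apply/eqP/funext => g; rewrite /coboundary big_ord0 addr0 mulrN1z subrr.
by exists (Cocycle uP).
Qed.

Lemma isomorphic_to_trivial (U W : zmodType) :
  zmod_isomorphic U W -> (forall w : W, w = 0) -> forall u : U, u = 0.
Proof.
by move=> [f /bij_inj f_inj] W0 u; apply: f_inj; rewrite !(W0 (f _)).
Qed.

(** * The complex attached to the presentation *)
Section EulerCharacteristic.
Local Open Scope vspace_scope.
Variables (K : fieldType) (U0 U1 U2 U3 U4 : vectType K).
Variables (f0 : 'Hom(U0, U1)) (f1 : 'Hom(U1, U2)) (f2 : 'Hom(U2, U3)).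
Variable (f3 : 'Hom(U3, U4)).

(** In a complex of finite dimensional spaces with Euler characteristic 0 that
    is exact elsewhere with one-dimensional ends, exactness at the remaining
    place is forced. *)
Lemma exact_by_dimension :
    (0 < \dim (lker f0))%N -> (lker f1 <= limg f0)%VS ->
    (limg f1 <= lker f2)%VS -> (lker f3 <= limg f2)%VS -> (dim U4 <= 1)%N ->
    (dim U0 + dim U2 = dim U1 + dim U3)%N ->
  (lker f2 <= limg f1)%VS.
Proof.
move=> k0 k1 k2 k3 d4 euler.
suff : (limg f1 == lker f2)%VS by move=> /eqP ->.
rewrite eqEdim k2 /=.
have := (limg_ker_dim f0 fullv, limg_ker_dim f1 fullv, limg_ker_dim f2 fullv,
         limg_ker_dim f3 fullv).
rewrite !capfv !dimvf => -[[[e0 e1] e2] e3].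
have := (dimvS k1, dimvS k3, dimvS (subvf (limg f3))); rewrite dimvf.
by move=> [[]]; lia.
Qed.

End EulerCharacteristic.

(** Functions on [G] are potentials on the vertices of the Cayley graph, with
    edges from [x] to [x s] and to [x t]; pairs of functions are cochains on the
    edges, or on the 2-cells attached along [s s = t s t] and [t t t t = s t s]. *)
Section CayleyComplex.
Variables (G : groupType) (s t : G) (A : comNzRingType).

Definition d0 (f : G -> A) : G -> A * A :=
  fun x => (f (x * s)%g - f x, f (x * t)%g - f x).

Definition d1 (w : G -> A * A) : G -> A * A := fun x =>
  ((w x).1 + (w (x * s)%g).1
     - ((w x).2 + (w (x * t)%g).1 + (w (x * t * s)%g).2),
   (w x).2 + (w (x * t)%g).2 + (w (x * t * t)%g).2 + (w (x * t * t * t)%g).2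
     - ((w x).1 + (w (x * s)%g).2 + (w (x * s * t)%g).1)).

Definition d2 (w : G -> A * A) : G -> A := fun x =>
  (w x).1 - (w (x * s)%g).1 + ((w x).2 - (w (x * t)%g).2).

Lemma fun_subE (V : zmodType) (f h : G -> V) x : (f - h) x = f x - h x.
Proof. by []. Qed.

Lemma pair_subE (U V : zmodType) (a c : U) (b d : V) :
  (a, b) - (c, d) = (a - c, b - d).
Proof. by []. Qed.

Lemma fst_subE (U V : zmodType) (u v : U * V) : (u - v).1 = u.1 - v.1.
Proof. by []. Qed.
Lemma snd_subE (U V : zmodType) (u v : U * V) : (u - v).2 = u.2 - v.2.
Proof. by []. Qed.

Fact d0_zmod_morphism : zmod_morphism d0.
Proof.
move=> f h; apply/funext => x; rewrite fun_subE /d0 pair_subE !fun_subE.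
by congr pair; ring.
Qed.
HB.instance Definition _ :=
  GRing.isZmodMorphism.Build (G -> A) (G -> A * A) d0 d0_zmod_morphism.

Fact d1_zmod_morphism : zmod_morphism d1.
Proof.
move=> f h; apply/funext => x; rewrite fun_subE /d1 pair_subE !fun_subE.
by rewrite !fst_subE !snd_subE; congr pair; ring.
Qed.
HB.instance Definition _ :=
  GRing.isZmodMorphism.Build (G -> A * A) (G -> A * A) d1 d1_zmod_morphism.

Fact d2_zmod_morphism : zmod_morphism d2.
Proof.
move=> f h; apply/funext => x; rewrite fun_subE /d2 !fun_subE.
by rewrite !fst_subE !snd_subE; ring.
Qed.
HB.instance Definition _ :=
  GRing.isZmodMorphism.Build (G -> A * A) (G -> A) d2 d2_zmod_morphism.

Hypotheses (relS : (s * s = t * s * t)%g).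
Hypotheses (relT : (t * t * t * t = s * t * s)%g).

Lemma relSx x : (x * s * s = x * t * s * t)%g.
Proof. by have := congr1 (fun y => x * y)%g relS; rewrite !mulgA. Qed.

Lemma relTx x : (x * t * t * t * t = x * s * t * s)%g.
Proof. by have := congr1 (fun y => x * y)%g relT; rewrite !mulgA. Qed.

Lemma d1_d0 f : d1 (d0 f) = 0.
Proof.
apply/funext => x; rewrite /d1 /d0 /=.
rewrite -relSx -relTx.
by rewrite [RHS](_ : _ = (0, 0)) //; congr pair; ring.
Qed.

(** The identity [(1 - s) R1 + (1 - t) R2 = 0] of Fox derivatives: every solid
    cell meets each kind of 2-cell twice, with opposite orientations. *)
Lemma d2_d1 w : d2 (d1 w) = 0.
Proof.
apply/funext => x; rewrite /d2 /d1 /=.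
rewrite -relSx -relTx.
by rewrite [RHS](_ : _ = 0) //; ring.
Qed.

Hypothesis generating :
  forall H : {pred G}, group_closed H -> s \in H -> t \in H -> forall x, x \in H.

(** The right periods of [f] form a subgroup containing [s] and [t]. *)
Lemma d0_eq0 f : d0 f = 0 -> f = cst (f 1%g).
Proof.
move=> df0; pose H : {pred G} := fun g => `[< forall x, f (x * g)%g = f x >].
suff HT g : g \in H.
  by apply/funext => g; have /asboolP/(_ 1%g) := HT g; rewrite mul1g.
have dfx x := congr1 (fun h => h x) df0.
apply: generating.
- split=> [|h k /asboolP fh /asboolP fk]; apply/asboolP => x.
    by rewrite mulg1.
  by rewrite mulgA -[LHS]fk mulgVK fh.
- by apply/asboolP => x; case: (dfx x) => /eqP; rewrite subr_eq0 => /eqP.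
- by apply/asboolP => x; case: (dfx x) => _ /eqP; rewrite subr_eq0 => /eqP.
Qed.

Variables (n : nat) (elt : 'I_n -> G) (idx : G -> 'I_n).
Hypotheses (eltK : cancel elt idx) (idxK : cancel idx elt).

Definition group_sum (f : G -> A) : A := \sum_i f (elt i).

Fact group_sum_zmod_morphism : zmod_morphism group_sum.
Proof. by move=> f h; rewrite /group_sum -sumrB. Qed.
HB.instance Definition _ :=
  GRing.isZmodMorphism.Build (G -> A) A group_sum group_sum_zmod_morphism.

Definition point (a : A) (x : G) : G -> A := fun y => a *+ (y == x).

Lemma group_sum_reindex (h : G -> G) (f : G -> A) :
  injective h -> group_sum (f \o h) = group_sum f.
Proof.
move=> h_inj; rewrite /group_sum [RHS](reindex (fun i => idx (h (elt i)))) /=.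
  by apply: eq_bigr => i _; rewrite idxK.
apply/onW_bij/injF_bij => i j /(can_inj idxK)/h_inj; exact: (can_inj eltK).
Qed.

Lemma group_sum_d2 w : group_sum (d2 w) = 0.
Proof.
rewrite /d2 /group_sum big_split !sumrB /=.
have R g (f : G -> A) : \sum_i f (elt i * g)%g = \sum_i f (elt i).
  exact: (group_sum_reindex (h := fun x => x * g)%g f (mulIg g)).
by rewrite (R s (fun x => (w x).1)) (R t (fun x => (w x).2)) !subrr addr0.
Qed.

(** Dually, the [g] such that every [point a (x g) - point a x] is in the image
    of [d2] form a subgroup, and functions of sum zero are combinations of such
    differences. *)
Lemma d2_onto f : group_sum f = 0 -> exists w, d2 w = f.
Proof.
pose H : {pred G} := fun g =>
  `[< forall a x, exists w, d2 w = point a (x * g)%g - point a x >].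
have HT g : g \in H.
  apply: generating.
  - split=> [|h k /asboolP Hh /asboolP Hk]; apply/asboolP => a x.
      by exists 0; rewrite raddf0 mulg1 subrr.
    have [u du] := Hh a x; have [v dv] := Hk a (x * h / k)%g.
    exists (u - v); rewrite raddfB /= du dv mulgVK mulgA.
    by rewrite opprB addrC addrA subrK.
  - apply/asboolP => a x; exists (fun y => (point a (x * s)%g y, 0)).
    apply/funext => y; rewrite /d2 /point /= subrr addr0 (inj_eq (mulIg s)).
    by [].
  - apply/asboolP => a x; exists (fun y => (0, point a (x * t)%g y)).
    apply/funext => y; rewrite /d2 /point /= subrr add0r (inj_eq (mulIg t)).
    by [].
move=> f0.
have /choice[w dw] i :
    exists w, d2 w = point (f (elt i)) (elt i) - point (f (elt i)) 1%g.
  by have /asboolP/(_ (f (elt i)) 1%g) := HT (elt i); rewrite mul1g.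
exists (\sum_i w i); rewrite raddf_sum; apply/funext => y.
rewrite (eq_bigr _ (fun i _ => dw i)) fct_sumE sumrB.
rewrite /point [X in _ - X]sumrMnl -[\sum_i f _]/(group_sum f) f0 mul0rn subr0.
rewrite (bigD1 (idx y)) //= idxK eqxx mulr1n big1 ?addr0 // => i iy.
case: eqP => // yi; by rewrite yi eltK eqxx in iy.
Qed.

End CayleyComplex.

(** * Exactness and periodicity *)
Definition trivial_subgroup (A : zmodType) : {pred A} := pred1 0.

Arguments trivial_subgroup : clear implicits.

Fact trivial_subgroup_zmod_closed (A : zmodType) : zmod_closed (trivial_subgroup A).
Proof. by split=> [|x y /eqP-> /eqP->]; apply/eqP; rewrite // subrr. Qed.
HB.instance Definition _ (A : zmodType) :=
  GRing.isZmodClosed.Build A (trivial_subgroup A) (@trivial_subgroup_zmod_closed A).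

Lemma intr_Zp_eq0 n (a : int) : (1 < n)%N -> (a%:~R == 0 :> 'Z_n) = (n %| a)%Z.
Proof.
move=> n_gt1; have natE k : (k%:R == 0 :> 'Z_n) = (n %| k)%N.
  by rewrite -val_eqE /= val_Zp_nat.
by rewrite /dvdz; case: a => k; rewrite ?NegzE ?mulrNz ?oppr_eq0 -pmulrn natE ?abszN.
Qed.

Section Resolution.
Variables (G : groupType) (s t : G).
Hypotheses (relS : (s * s = t * s * t)%g).
Hypotheses (relT : (t * t * t * t = s * t * s)%g).
Hypothesis generating :
  forall H : {pred G}, group_closed H -> s \in H -> t \in H -> forall x, x \in H.
Variables (n : nat) (elt : 'I_n -> G) (idx : G -> 'I_n).
Hypotheses (eltK : cancel elt idx) (idxK : cancel idx elt).
(** Simple connectedness of the 2-complex of the presentation, modulo a subgroup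
    [D]: both 0 and the multiples of an integer will play this role. *)
Hypothesis potential :
  forall (A : comNzRingType) (D : zmodClosed A) (w : G -> A * A),
    (forall x, (d1 s t w x).1 \in D /\ (d1 s t w x).2 \in D) ->
  exists f, forall x, ((w - d0 s t f) x).1 \in D /\ ((w - d0 s t f) x).2 \in D.

(** The instance of [potential] that says a closed cochain is exact. *)
Lemma exact1 (A : comNzRingType) (w : G -> A * A) :
  d1 s t w = 0 -> exists f, d0 s t f = w.
Proof.
move=> dw; have [|f fP] := @potential A (trivial_subgroup A) w.
  by move=> x; rewrite dw; split; apply/eqP.
exists f; apply/funext => x; have [/eqP w1 /eqP w2] := fP x.
apply/esym/eqP; rewrite -subr_eq0 -fun_subE; apply/eqP.
by rewrite [LHS]surjective_pairing w1 w2.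
Qed.

(** Functions on [G] only form a finite dimensional space after reindexing by
    ['I_n]; the maps between them are linear over the rationals because they are
    additive. *)
Section Transport.
Variables (U V : vectType rat) (d : {additive (G -> U) -> (G -> V)}).

Definition transport_fun (f : {ffun 'I_n -> U}) : {ffun 'I_n -> V} :=
  [ffun i => d (f \o idx) (elt i)].

Fact transport_zmod_morphism : zmod_morphism transport_fun.
Proof.
move=> f h; apply/ffunP => i; rewrite !ffunE -fun_subE -raddfB.
by congr (d _ _); apply/funext => y; rewrite fun_subE /= !ffunE.
Qed.
HB.instance Definition _ :=
  GRing.isZmodMorphism.Build {ffun 'I_n -> U} {ffun 'I_n -> V} transport_fun
    transport_zmod_morphism.
HB.instance Definition _ :=
  GRing.isScalable.Build rat {ffun 'I_n -> U} {ffun 'I_n -> V} _ transport_fun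
    (rat_linear transport_zmod_morphism).

Definition transport : 'Hom({ffun 'I_n -> U}, {ffun 'I_n -> V}) :=
  linfun transport_fun.

Lemma transportE f x : transport f (idx x) = d (f \o idx) x.
Proof. by rewrite lfunE /= ffunE idxK. Qed.

Lemma transport_comp (f : G -> U) :
  transport [ffun i => f (elt i)] = [ffun i => d f (elt i)].
Proof.
apply/ffunP => i; rewrite lfunE /= !ffunE; congr (d _ _).
by apply/funext => y; rewrite /= ffunE idxK.
Qed.
End Transport.

(** Over a field, exactness at the faces is a consequence of exactness at the
    other places, the Euler characteristic being n - 2 n + 2 n - n = 0. *)
Lemma exact2_rat (w : G -> rat * rat) :
  d2 s t w = 0 -> exists v, d1 s t v = w.
Proof.
pose Q : vectType rat := rat^o; pose Q2 : vectType rat := (Q * Q)%type.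
pose D0 : {additive (G -> Q) -> (G -> Q2)} := @d0 G s t rat.
pose D1 : {additive (G -> Q2) -> (G -> Q2)} := @d1 G s t rat.
pose D2 : {additive (G -> Q2) -> (G -> Q)} := @d2 G s t rat.
pose f0 := transport D0; pose f1 := transport D1; pose f2 := transport D2.
have sum_linear : linear (fun f : {ffun 'I_n -> Q} => \sum_i f i).
  move=> a f h; rewrite scaler_sumr -big_split /=.
  by apply: eq_bigr => i _; rewrite !ffunE.
pose sumL := GRing.isLinear.Build _ _ _ _ _ sum_linear.
pose sum : {linear {ffun 'I_n -> Q} -> Q} :=
  HB.pack (fun f : {ffun 'I_n -> Q} => \sum_i f i) sumL.
have extend (V : vectType rat) (f : {ffun 'I_n -> V}) :
    f = [ffun i => (f \o idx) (elt i)].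
  by apply/ffunP => i; rewrite ffunE /= eltK.
have extend0 (V : vectType rat) (f : G -> V) : f = 0 -> [ffun i => f (elt i)] = 0.
  by move=> ->; apply/ffunP => i; rewrite !ffunE.
have f1_ker u : f1 u = 0 -> d1 s t (u \o idx) = 0.
  by move=> f1u; apply/funext => x; rewrite -[LHS](transportE D1 u) -/f1 f1u ffunE.
have k0 : (0 < \dim (lker f0))%N.
  rewrite lt0n dimv_eq0; apply/eqP => ker0.
  pose one : {ffun 'I_n -> Q} := [ffun=> (1 : rat)].
  have : one \in lker f0.
    rewrite memv_ker (extend _ one) transport_comp extend0 //.
    by apply/funext => x; rewrite /= /d0 /= !ffunE subrr.
  rewrite ker0 memv0 => /eqP/ffunP/(_ (idx 1%g)); rewrite !ffunE => /eqP.
  by rewrite oner_eq0.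
have k1 : (lker f1 <= limg f0)%VS.
  apply/subvP => u; rewrite memv_ker => /eqP/f1_ker/exact1[f fu].
  apply/memv_imgP; exists [ffun i => f (elt i)]; first exact: memvf.
  by rewrite transport_comp /= fu -extend.
have k2 : (limg f1 <= lker f2)%VS.
  apply/subvP => _ /memv_imgP[u _ ->]; rewrite memv_ker (extend _ u).
  by rewrite !transport_comp extend0 //; apply: d2_d1.
have k3 : (lker (linfun sum) <= limg f2)%VS.
  apply/subvP => u; rewrite memv_ker lfunE /= => /eqP u0.
  have [|v vu] := d2_onto generating eltK idxK (f := u \o idx).
    by rewrite /group_sum -[RHS]u0; apply: eq_bigr => i _; rewrite /= eltK.
  apply/memv_imgP; exists [ffun i => v (elt i)]; first exact: memvf.
  by rewrite transport_comp /= vu -extend.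
move=> dw; pose wf : {ffun 'I_n -> Q2} := [ffun i => w (elt i)].
have wk : wf \in lker f2.
  by rewrite memv_ker transport_comp extend0.
have /subvP/(_ _ wk) := exact_by_dimension k0 k1 k2 k3 (leqnn 1) (addnC _ _).
move=> /memv_imgP[v _ wv]; exists (v \o idx); apply/funext => x.
by rewrite -[LHS](transportE D1 v) -/f1 -wv ffunE idxK.
Qed.

Lemma clear_denominators (v : G -> rat * rat) :
  exists2 m : int, m != 0 & exists u : G -> int * int, forall x,
    m%:~R * (v x).1 = (u x).1%:~R /\ m%:~R * (v x).2 = (u x).2%:~R.
Proof.
pose den x := denq (v x).1 * denq (v x).2.
exists (\prod_i den (elt i)).
  by apply/prodf_neq0 => i _; rewrite mulf_neq0 ?denq_neq0.
have /choice[u uP] x : exists a : int * int,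
    (\prod_i den (elt i))%:~R * (v x).1 = a.1%:~R
    /\ (\prod_i den (elt i))%:~R * (v x).2 = a.2%:~R.
  rewrite (bigD1 (idx x)) //= idxK /den; set b := \prod_(i < n | _) _.
  exists (denq (v x).2 * b * numq (v x).1, denq (v x).1 * b * numq (v x).2) => /=.
  by rewrite !rmorphM /= !numqE; split; ring.
by exists u.
Qed.

(** A rational solution [v] of [d1 v = w] gives an integral [u] with
    [d1 u = m w].  Modulo [m], [u] is closed, so it is exact by [potential];
    subtracting the coboundary makes [u] divisible by [m]. *)
Lemma exact2 (w : G -> int * int) :
  d2 s t w = 0 -> exists v, d1 s t v = w.
Proof.
move=> dw; pose toQ (a : int * int) : rat * rat := (a.1%:~R, a.2%:~R).
have [|v vw] := @exact2_rat (toQ \o w).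
  apply/funext => x; transitivity ((d2 s t w x)%:~R : rat).
    by rewrite /d2 /= !(intrD, mulrNz).
  by rewrite dw.
have [m m0 [u uP]] := clear_denominators v.
have du x : d1 s t u x = (m * (w x).1, m * (w x).2).
  have [v1 v2] : d1 s t v x = toQ (w x) by rewrite vw.
  rewrite /d1; congr pair; apply: (@intr_inj rat).
    rewrite intrM -v1 !(intrD, mulrNz) /=.
    by rewrite -!(proj1 (uP _)) -!(proj2 (uP _)); ring.
  rewrite intrM -v2 !(intrD, mulrNz) /=.
  by rewrite -!(proj1 (uP _)) -!(proj2 (uP _)); ring.
have [|f fP] := @potential int [the zmodClosed int of (dvdz m : {pred int})] u.
  by move=> x; rewrite du /= ?dvdz_mulr.
have /choice[y yP] x : exists a : int * int,
    m * a.1 = ((u - d0 s t f) x).1 /\ m * a.2 = ((u - d0 s t f) x).2.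
  have [/dvdzP[a ua] /dvdzP[b ub]] := fP x.
  by exists (a, b); rewrite ua ub /= !(mulrC m).
exists y.
(* Subtracting [d0 f] from [u] leaves [d1 u] unchanged. *)
have d1my x : d1 s t u x = (m * (d1 s t y x).1, m * (d1 s t y x).2).
  have -> : d1 s t u = d1 s t (u - d0 s t f).
    by rewrite raddfB /= d1_d0 // subr0.
  rewrite /d1 -!(proj1 (yP _)) -!(proj2 (yP _)) /=; congr pair; ring.
apply/funext => x; have := d1my x; rewrite du => -[/(mulfI m0) e1 /(mulfI m0) e2].
by rewrite [RHS]surjective_pairing e1 e2.
Qed.

Local Notation Z := (trivial_gmodule G int).
Local Notation C0 := (coinduced G int).
Local Notation C1 := (coinduced G (int * int)%type).

Definition delta0 : {additive C0 -> C1} := @d0 G s t int.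
Definition delta1 : {additive C1 -> C1} := @d1 G s t int.
Definition delta2 : {additive C1 -> C0} := @d2 G s t int.
Definition sum_values : {additive C0 -> Z} := group_sum elt.

Fact constant_zmod_morphism : zmod_morphism (cst : int -> G -> int).
Proof. by []. Qed.
HB.instance Definition _ :=
  GRing.isZmodMorphism.Build int (G -> int) (cst : int -> G -> int)
    constant_zmod_morphism.
Definition constants : {additive Z -> C0} := (cst : int -> G -> int).

Lemma delta0_equivariant : equivariant delta0.
Proof.
by move=> g f; apply/funext => x; rewrite /= /d0 /translate /= !mulgA.
Qed.

Lemma delta1_equivariant : equivariant delta1.
Proof.
by move=> g f; apply/funext => x; rewrite /= /d1 /translate /= !mulgA.
Qed.

Lemma delta2_equivariant : equivariant delta2.
Proof.
by move=> g f; apply/funext => x; rewrite /= /d2 /translate /= !mulgA.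
Qed.

Lemma sum_values_equivariant : equivariant sum_values.
Proof. by move=> g f; apply: (group_sum_reindex eltK idxK f (@mulgI G g^-1)%g). Qed.

Lemma constants_equivariant : equivariant constants.
Proof. by []. Qed.

Local Notation K1 := (kernel delta1_equivariant).
Local Notation K2 := (kernel delta2_equivariant).
Local Notation K3 := (kernel sum_values_equivariant).

Let gt0 : (0 < n)%N. Proof. exact: leq_ltn_trans (ltn_ord (idx 1%g)). Qed.

Lemma fixed_constant (V : zmodType) (f : coinduced G V) :
  fixed_by_group f -> f = cst (f 1%g).
Proof.
move=> f_inv; apply/funext => x.
by rewrite -[in LHS](f_inv x) /= /translate mulVg.
Qed.

Lemma group_sum_cst (a : int) : group_sum elt (cst a) = a *+ n.
Proof. by rewrite /group_sum sumr_const card_ord. Qed.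

(* The short exact sequence 0 -> int -> (G -> int) -> K1 -> 0. *)
Let i0 : {additive Z -> C0} := constants.
Let p0 : {additive C0 -> K1} :=
  corestrict (e := delta0) delta1_equivariant (d1_d0 relS relT).

Let p0_equivariant : equivariant p0.
Proof. exact: corestrict_equivariant delta0_equivariant _. Qed.

Let i0_inj : injective i0.
Proof. by move=> a b /(congr1 (fun f => f 1%g)). Qed.

Let p0i0 a : p0 (i0 a) = 0.
Proof. by apply/val_inj/funext => x; congr pair; exact: subrr. Qed.

Let p0_surj b : exists c, p0 c = b.
Proof.
by have [c cb] := exact1 (eqP (valP b)); exists c; apply/val_inj.
Qed.

Let exact0 c : p0 c = 0 -> exists a, i0 a = c.
Proof.
move=> /(congr1 val) /(d0_eq0 generating) pc; exists (c 1%g).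
by rewrite [RHS]pc.
Qed.

Lemma shift_Z q : zmod_isomorphic (cohomology G Z q.+2) (cohomology G K1 q.+1).
Proof.
exact: (dimension_shift constants_equivariant p0_equivariant i0_inj p0_surj
          p0i0 exact0).
Qed.

(** An invariant element of [K1] is a constant pair [(u, v)] killed by [d1]:
    [u = 2 v] and [3 v = 2 u], so it vanishes. *)
Lemma H1_Z (x : cohomology G Z 1) : x = 0.
Proof.
move: x.
apply: (H1_eq0 constants_equivariant p0_equivariant i0_inj p0i0 exact0) => b b_inv.
have b_cst : val b = cst (val b 1%g).
  by apply: fixed_constant => g; have /(congr1 val) := b_inv g.
have : d1 s t (val b) 1%g = 0 by have /(congr1 (fun f => f 1%g)) := eqP (valP b).
rewrite b_cst; case: (val b 1%g) (b_cst) => u v bE; rewrite /d1 /= => -[e1 e2].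
exists 0; apply/val_inj; rewrite /= bE; apply/funext => y.
rewrite [RHS](_ : _ = (0, 0)) /cst; last by congr pair; exact: subrr.
by congr pair; lia.
Qed.

Lemma shift_K1 q : zmod_isomorphic (cohomology G K1 q.+2) (cohomology G K2 q.+1).
Proof.
exact: (kernel_shift delta1_equivariant delta2_equivariant (d2_d1 relS relT)
          exact2).
Qed.

(** On constants [d1] is the integer matrix with rows [(1, -2)] and [(-2, 3)],
    of determinant -1; the witness below is the inverse matrix. *)
Lemma H1_K1 (x : cohomology G K1 1) : x = 0.
Proof.
move: x; apply: (kernel_H1_eq0 (g := delta2) delta2_equivariant (d2_d1 relS relT)).
move=> m _ /fixed_constant ->; case: (m 1%g) => a b.
exists (- (3 * a) - 2 * b, - (2 * a) - b); apply/funext => x.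
by rewrite /= /d1 /cst /=; congr pair; lia.
Qed.

Lemma shift_K2 q : zmod_isomorphic (cohomology G K2 q.+2) (cohomology G K3 q.+1).
Proof.
exact: (kernel_shift delta2_equivariant sum_values_equivariant
          (group_sum_d2 s t eltK idxK)
          (d2_onto generating eltK idxK)).
Qed.

(** A constant of sum zero vanishes. *)
Lemma H1_K2 (x : cohomology G K2 1) : x = 0.
Proof.
move: x; apply: (kernel_H1_eq0 (g := sum_values) sum_values_equivariant
  (group_sum_d2 s t eltK idxK)).
move=> m m0 /fixed_constant mE; exists 0; rewrite raddf0 mE.
move: m0; rewrite mE /= group_sum_cst => /eqP.
by rewrite mulrn_eq0 eqn0Ngt gt0 /= => /eqP ->.
Qed.

(* The short exact sequence 0 -> K3 -> (G -> int) -> int -> 0. *)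
Let i3 : {additive K3 -> C0} := val.

Let p3_surj (b : Z) : exists c, sum_values c = b.
Proof.
exists (point b 1%g); rewrite /= /group_sum /point (bigD1 (idx 1%g)) //= idxK eqxx.
rewrite big1 ?addr0 // => i; apply: contraNeq.
by rewrite mulrn_eq0 negb_or -lt0n lt0b => /andP[/eqP <- _]; rewrite eltK.
Qed.

Let p3i3 a : sum_values (i3 a) = 0. Proof. exact/eqP/(valP a). Qed.

Let exact3 c : sum_values c = 0 -> exists a, i3 a = c.
Proof.
move=> c0; have cK : c \in in_kernel sum_values by apply/eqP.
by exists (KernelElt cK).
Qed.

Lemma shift_K3 q : zmod_isomorphic (cohomology G K3 q.+2) (cohomology G Z q.+1).
Proof.
apply: (dimension_shift (i := i3) _ sum_values_equivariant val_inj p3_surj p3i3 exact3).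
by [].
Qed.

(** Constants of [G -> int] have sum a multiple of [n], which makes the first
    cohomology of [K3] the quotient of [int] by [n]. *)
Lemma H1_K3 : (1 < n)%N -> zmod_isomorphic (cohomology G K3 1) 'Z_n.
Proof.
move=> n_gt1; pose g0 (i : 'I_0) : G := 1%g.
have ev_zmod : zmod_morphism (fun z : cocycle Z 0 => (val z g0 : int)%:~R : 'Z_n).
  by move=> z z'; rewrite -rmorphB.
pose evM := GRing.isZmodMorphism.Build _ _ _ ev_zmod.
pose ev : {additive cocycle Z 0 -> 'Z_n} :=
  HB.pack (fun z : cocycle Z 0 => (val z g0 : int)%:~R : 'Z_n) evM.
apply: (@cohomology_iso _ _ _ _ i3 sum_values _ sum_values_equivariant val_inj
         p3_surj p3i3 exact3 0 'Z_n ev) => [|w|u].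
- by [].
- rewrite lifts0; split=> [/eqP|[v wv]].
    rewrite /= (intr_Zp_eq0 _ n_gt1) => /dvdzP[v wv]; exists v => g.
    rewrite (ord0_tupleP g g0) wv; apply/esym; rewrite /= group_sum_cst.
    by rewrite -mulr_natr natz.
  apply/eqP; rewrite /= (intr_Zp_eq0 _ n_gt1) wv; apply/dvdzP; exists v.
  by rewrite /= group_sum_cst -mulr_natr natz.
- have uP : (fun=> (u : nat)%:Z) \in @is_cocycle G Z 0.
    by apply/eqP/funext => g; rewrite /coboundary big_ord0 addr0 mulrN1z subrr.
  by exists (Cocycle uP); rewrite /= -pmulrn natr_Zp.
Qed.

(** Walking once around the complex shifts the degree by 4; the four initial
    degrees are read off the invariants. *)
Theorem cohomology_period4 q : (1 < n)%N ->
  [/\ (0 < q)%N -> (4 %| q)%N -> zmod_isomorphic (cohomology G Z q) 'Z_n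
    & ~~ (4 %| q)%N -> forall x : cohomology G Z q, x = 0].
Proof.
move=> n_gt1.
have shift4 p : zmod_isomorphic (cohomology G Z p.+4.+1) (cohomology G Z p.+1).
  apply: zmod_isomorphic_trans (shift_Z _) _.
  apply: zmod_isomorphic_trans (shift_K1 _) _.
  by apply: zmod_isomorphic_trans (shift_K2 _) (shift_K3 _).
elim/ltn_ind: q => q IHq.
have [q_lt5|q_ge5] := ltnP q 5; last first.
  have := shift4 (q - 5)%N; have -> : (q - 5).+4.+1 = q by lia.
  move=> shift_q.
  have [|iso trivial] := IHq (q - 5).+1; first lia.
  split=> [_|] q4.
    by apply: zmod_isomorphic_trans shift_q (iso _ _); lia.
  by apply: isomorphic_to_trivial shift_q (trivial _); lia.
case: q q_lt5 IHq => [|[|[|[|[|//]]]]] _ _; split=> // _.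
- exact: H1_Z.
- exact: isomorphic_to_trivial (shift_Z 0) H1_K1.
- apply: isomorphic_to_trivial H1_K2.
  exact: zmod_isomorphic_trans (shift_Z 1) (shift_K1 0).
- move=> _; apply: zmod_isomorphic_trans (shift_Z 2) _.
  apply: zmod_isomorphic_trans (shift_K1 1) _.
  exact: zmod_isomorphic_trans (shift_K2 0) (H1_K3 n_gt1).
Qed.

End Resolution.

(** * Simple connectedness by saturation of relators *)

(** Vertices are numbered; the edge [(b, i)] goes from [i] to [next b i], with
    [false] standing for [s] and [true] for [t].  An edge is known when a cochain
    subject to the hypotheses below must take a value in [D] on it. *)
Section Saturation.
Variables (n : nat) (next : bool -> nat -> nat) (word : nat -> seq bool).

Definition knowledge := (seq bool * seq bool)%type.

Definition known (k : knowledge) (e : bool * nat) : bool :=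
  nth false (if e.1 then k.2 else k.1) e.2.

Definition mark (k : knowledge) (e : bool * nat) : knowledge :=
  if e.1 then (k.1, set_nth false k.2 e.2 true)
  else (set_nth false k.1 e.2 true, k.2).

(** The words name paths from the base vertex; an edge along which a path
    extends another belongs to the spanning tree they form. *)
Definition tree_edges : knowledge :=
  let along b := mkseq (fun i => word (next b i) == rcons (word i) b) n in
  (along false, along true).

Fixpoint path_edges (i : nat) (v : seq bool) : seq (bool * nat) :=
  if v is b :: v' then (b, i) :: path_edges (next b i) v' else [::].

Definition walk (i : nat) (v : seq bool) : nat := foldl (fun j b => next b j) i v.

Definition relations : seq (seq bool * seq bool) :=
  [:: ([:: false; false], [:: true; false; true]);
      ([:: true; true; true; true], [:: false; true; false])].

Definition cells : seq (seq (bool * nat) * seq (bool * nat)) :=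
  [seq (path_edges i r.1, path_edges i r.2) | i <- iota 0 n, r <- relations].

(** A cell all of whose edges but one are known determines the last one; an
    unknown edge that occurs twice is listed twice, and is not marked. *)
Definition propagate (k : knowledge) (c : seq (bool * nat) * seq (bool * nat)) :=
  if [seq e <- c.1 ++ c.2 | ~~ known k e] is [:: e] then mark k e else k.

Definition saturate (m : nat) : knowledge :=
  foldl propagate tree_edges (flatten (nseq m cells)).

Definition saturates (m : nat) : bool :=
  let k := saturate m in
  all (fun i => known k (false, i) && known k (true, i)) (iota 0 n).

Definition closes_up : bool :=
  all (fun i => all (fun r => walk i r.1 == walk i r.2) relations) (iota 0 n).

Variables (A : zmodType) (D : zmodClosed A) (c : bool * nat -> A).
Hypothesis treeD : forall b i, (i < n)%N ->
  word (next b i) = rcons (word i) b -> c (b, i) \in D.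
Hypothesis cellD : forall i r, (i < n)%N -> r \in relations ->
  \sum_(e <- path_edges i r.1) c e - \sum_(e <- path_edges i r.2) c e \in D.

Definition sound (k : knowledge) := forall e, known k e -> c e \in D.

Lemma tree_edges_sound : sound tree_edges.
Proof.
move=> [b i]; rewrite /known /=.
have [i_lt|i_ge] := ltnP i n; last by case: b; rewrite nth_default ?size_mkseq.
by case: b; rewrite nth_mkseq // => /eqP; apply: treeD.
Qed.

Lemma mark_sound k e : sound k -> c e \in D -> sound (mark k e).
Proof.
move=> kD eD [b' i'] /=; case: e eD => b i eD.
have [[-> ->] //|neq] := eqVneq (b', i') (b, i).
move=> ke; apply: kD; move: ke neq; rewrite /known /mark /=.
case: b {eD}; case: b' => //=; rewrite nth_set_nth /=.
- by case: (i' =P i) => // ->; rewrite eqxx.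
- by case: (i' =P i) => // ->; rewrite eqxx.
Qed.

Lemma propagate_sound k cell :
    \sum_(e <- cell.1) c e - \sum_(e <- cell.2) c e \in D ->
  sound k -> sound (propagate k cell).
Proof.
case: cell => l r /= lrD kD; rewrite /propagate /=.
case def: [seq _ <- _ | _] => [|e [|]] //; apply: mark_sound => //.
have rest s : \sum_(x <- s | known k x) c x \in D.
  by apply: rpred_sum => x; apply: kD.
have split_sum s : \sum_(x <- s) c x =
    \sum_(x <- s | known k x) c x + \sum_(x <- [seq x <- s | ~~ known k x]) c x.
  by rewrite (bigID (known k)) big_filter.
move: lrD; rewrite (split_sum l) (split_sum r) opprD addrACA.
rewrite (rpredDl _ (rpredB (rest l) (rest r))).
rewrite filter_cat in def; case: [seq _ <- l | _] def => [|x [|//]] /=.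
  by move=> ->; rewrite big_nil big_seq1 sub0r rpredN.
by case=> -> ->; rewrite big_nil big_seq1 subr0.
Qed.

Lemma saturates_sound m : saturates m ->
  forall b i, (i < n)%N -> c (b, i) \in D.
Proof.
move=> /allP sat b i i_lt.
have sat_sound : sound (saturate m).
  rewrite /saturate; move: tree_edges tree_edges_sound => k0.
  have : all (fun cell : seq (bool * nat) * seq (bool * nat) =>
      \sum_(e <- cell.1) c e - \sum_(e <- cell.2) c e \in D)
      (flatten (nseq m cells)).
    apply/allP => cell /flattenP[_ /nseqP[-> _]].
    case/allpairsP => -[j r] [jn rR ->] /=; apply: cellD rR.
    by rewrite mem_iota in jn.
  elim: (flatten _) k0 => //= cell cs IH k0 /andP[cellok csok] k0S.
  by apply: IH => //; apply: propagate_sound.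
apply: sat_sound; have := sat i; rewrite mem_iota /= => /(_ i_lt) /andP[].
by case: b.
Qed.

End Saturation.

(** * Exact arithmetic in the binary icosahedral group *)
Section IcosianModel.

(** [(a, b)] is [a + b psi], where [psi] is the root [1 - phi] of
    [x ^ 2 = x + 1]. *)
Definition golden := (int * int)%type.
Definition mul_psi (a : golden) : golden := (a.2, a.1 + a.2).

(** Coordinates on 1, [s], [t], [s t].  The quadratic equations
    [s s = s - 1], [t t = psi t - 1] and
    [t s = - psi + psi s + t - s t] make the span of these four quaternions over
    Z[psi] a ring, so that no denominators occur. *)
Definition icosian := (golden * golden * golden * golden)%type.
Definition icosian1 : icosian := ((1, 0), 0, 0, 0).

Definition mul_letter (b : bool) (x : icosian) : icosian :=
  let: (x1, xs, xt, xst) := x in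
  if b then (- xt, - xst, x1 + mul_psi xt, xs + mul_psi xst)
  else (- xs - mul_psi xt - mul_psi xst, x1 + xs + mul_psi xt, xt + xst, - xt).

Definition icosian_of (v : seq bool) : icosian :=
  foldl (fun x b => mul_letter b x) icosian1 v.

Definition visit (l : seq (seq bool)) (v : seq bool) : seq (seq bool) :=
  if icosian_of v \in [seq icosian_of u | u <- l] then l else rcons l v.

(** Breadth-first search of the Cayley graph: the resulting words form a
    prefix-closed set, i.e. a spanning tree. *)
Definition explore (m : nat) : seq (seq bool) :=
  foldl (fun l i => let v := nth [::] l i in
                    visit (visit l (rcons v false)) (rcons v true))
    [:: [::]] (iota 0 m).

Definition words := Eval vm_compute in explore 120.
Definition icosians := Eval vm_compute in [seq icosian_of v | v <- words].
Definition successor (b : bool) : seq nat :=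
  [seq index (mul_letter b x) icosians | x <- icosians].
Definition succ0 := Eval vm_compute in successor false.
Definition succ1 := Eval vm_compute in successor true.
Definition next (b : bool) (i : nat) := nth 0%N (if b then succ1 else succ0) i.

Definition icosian_word (i : nat) : seq bool := nth [::] words i.

Lemma size_icosians : size icosians = 120%N. Proof. by vm_compute. Qed.

Lemma uniq_icosians : uniq icosians. Proof. by vm_compute. Qed.

Lemma icosians_words : icosians = [seq icosian_of v | v <- words].
Proof. by vm_compute. Qed.

Lemma next_lt b i : (i < 120)%N -> (next b i < 120)%N.
Proof.
have /allP next_ok : all (fun j => (next false j < 120) && (next true j < 120))%N
                       (iota 0 120) by vm_compute.
by move=> i_lt; have := next_ok i; rewrite mem_iota => /(_ i_lt)/andP[]; case: b.
Qed.

(** Four rounds over all relators reach every edge from the tree. *)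
Lemma icosians_saturate : saturates 120 next icosian_word 4.
Proof. by vm_compute. Qed.

Lemma icosians_close_up : closes_up 120 next.
Proof. by vm_compute. Qed.

Lemma nth_icosians i : (i < 120)%N ->
  nth icosian1 icosians i = icosian_of (icosian_word i).
Proof.
move=> i_lt; rewrite icosians_words (nth_map [::]) //.
Qed.

Lemma nth_next b i : (i < 120)%N ->
  nth icosian1 icosians (next b i) = mul_letter b (nth icosian1 icosians i).
Proof.
move=> i_lt; have succE : (if b then succ1 else succ0) = successor b.
  by case: b; vm_compute.
have nextE : next b i = index (mul_letter b (nth icosian1 icosians i)) icosians.
  by rewrite /next succE (nth_map icosian1) ?size_icosians.
rewrite nextE nth_index // -index_mem -nextE size_icosians.
exact: next_lt.
Qed.

End IcosianModel.

(** * The binary icosahedral group as a group of icosians *)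
Section Realization.
Variable R : realType.

Definition psi : R := 1 - phi R.

Lemma psi2 : psi ^+ 2 = psi + 1.
Proof. by rewrite /psi sqrrB phi2; ring. Qed.

Lemma phiV : (phi R)^-1 = - psi.
Proof.
apply: (mulfI (phi_neq0 R)); rewrite divff ?phi_neq0 // /psi.
have := phi2 R; rewrite expr2 => p2; rewrite opprB mulrBr mulr1 p2; ring.
Qed.

Definition of_golden (a : golden) : R := a.1%:~R + a.2%:~R * psi.

Lemma of_goldenD a b : of_golden (a + b) = of_golden a + of_golden b.
Proof. rewrite /of_golden /= !intrD; ring. Qed.

Lemma of_goldenN a : of_golden (- a) = - of_golden a.
Proof. rewrite /of_golden /= !mulrNz; ring. Qed.

Lemma of_golden_psi a : of_golden (mul_psi a) = psi * of_golden a.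
Proof.
rewrite /of_golden /= intrD.
rewrite [RHS](_ : _ = a.1%:~R * psi + a.2%:~R * psi ^+ 2); last by ring.
by rewrite psi2; ring.
Qed.

(** The exponent of 5 is even on the left and odd on the right. *)
Lemma sqr_eq5sqr (m n : nat) : (m ^ 2 = 5 * n ^ 2)%N -> n = 0%N.
Proof.
case: n => // n e; have := congr1 (logn 5) e.
rewrite lognX lognM // lognX (_ : logn 5 5 = 1%N) // => /(congr1 odd).
by rewrite oddD !oddM.
Qed.

(** The norm [m ^ 2 + m n - n ^ 2] of [m + n psi] can vanish only at 0, since 5
    is not a rational square. *)
Lemma of_golden_inj : injective of_golden.
Proof.
suff ker0 a : of_golden a = 0 -> a = 0.
  move=> a b ab; apply/eqP; rewrite -subr_eq0; apply/eqP/ker0.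
  by rewrite of_goldenD of_goldenN ab subrr.
case: a => m n; rewrite /of_golden /= => a0.
have n0 : n = 0.
  (* Four times the norm of [m + n psi], a multiple of it in Z[psi]. *)
  have norm0 : ((2 * m + n) ^+ 2 - 5 * n ^+ 2)%:~R = 0 :> R.
    have -> : ((2 * m + n) ^+ 2 - 5 * n ^+ 2)%:~R
      = 4 * ((m%:~R + n%:~R * psi) * (m%:~R + n%:~R * (1 - psi)))
        + 4 * n%:~R ^+ 2 * (psi ^+ 2 - psi - 1) :> R.
      by rewrite !(intrD, mulrNz, intrM, rmorphXn) /=; ring.
    by rewrite a0 psi2; ring.
  move/eqP: norm0; rewrite intr_eq0 subr_eq0 => /eqP e.
  apply/eqP; rewrite -absz_eq0; apply/eqP.
  apply: (@sqr_eq5sqr (absz (2 * m + n)) (absz n)).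
  by rewrite -!abszX e abszM.
move: a0; rewrite n0 mul0r addr0 => /eqP; rewrite intr_eq0 => /eqP ->.
by [].
Qed.

(** The quaternion with the given coordinates, using
    [s = (1 - psi i - phi k) / 2], [t = (psi - i - phi j) / 2] and
    [s t = - i]. *)
Definition realize (x : icosian) : quaternion R :=
  let: (x1, xs, xt, xst) := x in
  let a := of_golden x1 in let b := of_golden xs in
  let c := of_golden xt in let d := of_golden xst in
  Quat (a + b / 2 + c * psi / 2) (- (b * psi / 2) - c / 2 - d)
       (- (c * phi R / 2)) (- (b * phi R / 2)).

(** The components along [j] and [k] each involve a single coordinate. *)
Lemma realize_inj : injective realize.
Proof.
move=> [[[x1 xs] xt] xst] [[[y1 ys] yt] yst] [e1 ei ej ek].
have phi2_neq0 : phi R / 2 != 0 by rewrite mulf_neq0 ?phi_neq0 ?invr_eq0 ?pnatr_eq0.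
have et : xt = yt.
  apply/of_golden_inj/(mulIf phi2_neq0); rewrite !(mulrA _ (phi R)).
  exact: oppr_inj ej.
have es : xs = ys.
  apply/of_golden_inj/(mulIf phi2_neq0); rewrite !(mulrA _ (phi R)).
  exact: oppr_inj ek.
move: e1 ei; rewrite et es => /addIr/addIr/of_golden_inj -> /addrI/oppr_inj.
by move=> /of_golden_inj ->.
Qed.

Definition quat_s : quaternion R := Quat (1 / 2) (- (psi / 2)) 0 (- (phi R / 2)).
Definition quat_t : quaternion R := Quat (psi / 2) (- (1 / 2)) (- (phi R / 2)) 0.

Lemma realize_mul_letter b x :
  realize (mul_letter b x) = qmul (realize x) (if b then quat_t else quat_s).
Proof.
case: x => [[[x1 xs] xt] xst]; have phiE : phi R = 1 - psi by rewrite /psi; ring.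
case: b; rewrite /realize /mul_letter /= !(of_goldenD, of_goldenN, of_golden_psi) phiE.
all: move: (of_golden x1) (of_golden xs) (of_golden xt) (of_golden xst) => a b c d.
all: by congr Quat; field: psi2.
Qed.

Local Notation G := (binary_icosahedral R).
Local Notation S := [in [:: uq_i R; uq_omega R]].

Fact uq_i_generated : uq_i R \in generated S.
Proof. by apply/asboolP => H _; apply; rewrite inE eqxx. Qed.
Fact uq_omega_generated : uq_omega R \in generated S.
Proof. by apply/asboolP => H _; apply; rewrite !inE eqxx orbT. Qed.

Definition elt_i : G := GeneratedElt uq_i_generated.
Definition elt_omega : G := GeneratedElt uq_omega_generated.
Definition elt_s : G := (elt_i / elt_omega)%g.
Definition elt_t : G := (elt_i * elt_i * elt_omega)%g.

Definition letter (b : bool) : G := if b then elt_t else elt_s.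
Definition group_word (v : seq bool) : G := foldl (fun g b => g * letter b)%g 1%g v.

Definition quat (g : G) : quaternion R := uquat (gval g).

Lemma quat_inj : injective quat. Proof. by move=> g h /val_inj/val_inj. Qed.

Lemma quatM g h : quat (g * h)%g = qmul (quat g) (quat h). Proof. by []. Qed.

Lemma quat_letter b : quat (letter b) = if b then quat_t else quat_s.
Proof.
have phiE : phi R = 1 - psi by rewrite /psi; ring.
case: b; rewrite /quat /= /quat_s /quat_t phiV phiE;
  by congr Quat; field.
Qed.

Lemma quat_group_word v : quat (group_word v) = realize (icosian_of v).
Proof.
elim/last_ind: v => [|v b IH].
  rewrite /quat /realize /of_golden /=; congr Quat; rewrite ?mulr0z; ring.
rewrite /group_word /icosian_of !foldl_rcons quatM -/(group_word v) IH.
by rewrite realize_mul_letter quat_letter.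
Qed.

Lemma group_word_eq u v : icosian_of u = icosian_of v -> group_word u = group_word v.
Proof. by move=> uv; apply: quat_inj; rewrite !quat_group_word uv. Qed.

Lemma relation_s : (elt_s * elt_s = elt_t * elt_s * elt_t)%g.
Proof.
have := @group_word_eq [:: false; false] [:: true; false; true] erefl.
by rewrite /group_word /= !mul1g.
Qed.

Lemma relation_t : (elt_t * elt_t * elt_t * elt_t = elt_s * elt_t * elt_s)%g.
Proof.
have := @group_word_eq [:: true; true; true; true] [:: false; true; false] erefl.
by rewrite /group_word /= !mul1g.
Qed.

(** [s t = - i], so its inverse is [i]; and [t] is [i i omega]. *)
Lemma generating (H : {pred G}) :
  group_closed H -> elt_s \in H -> elt_t \in H -> forall x, x \in H.
Proof.
move=> H_closed Hs Ht.
have HV := group_closedV H_closed; have HM := group_closedM H_closed.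
(* [generated] quantifies over predicates on all unit quaternions. *)
pose H' : {pred unit_quaternion R} :=
  fun g => `[< exists2 h : G, gval h = g & h \in H >].
suff H'_all g : g \in generated S -> g \in H'.
  case=> g g_gen; have /asboolP[h hg hH] := H'_all g g_gen.
  by rewrite (_ : GeneratedElt g_gen = h) //; apply/val_inj.
move=> /asboolP; apply.
  split=> [|x y /asboolP[u <- uH] /asboolP[v <- vH]]; apply/asboolP.
    by exists 1%g => //; apply: H_closed.1.
  by exists (u / v)%g => //; apply: H_closed.2.
have s_t : (elt_s * elt_t)%g = elt_i^-1%g.
  apply: quat_inj; rewrite quatM -[elt_s]/(letter false) -[elt_t]/(letter true).
  rewrite !quat_letter /quat /=; have phiE : phi R = 1 - psi by rewrite /psi; ring.
  by rewrite /quat_s /quat_t /= phiE; congr Quat => /=; field: psi2.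
have iH : elt_i \in H by rewrite -[elt_i]invgK -s_t; apply: (HV); apply: (HM).
have omegaH : elt_omega \in H.
  have -> : elt_omega = ((elt_i * elt_i)^-1 * elt_t)%g by rewrite mulKg.
  by apply: (HM) => //; apply: (HV); apply: (HM).
move=> x; rewrite !inE => /orP[]/eqP->; apply/asboolP.
  by exists elt_i.
by exists elt_omega.
Qed.

Definition elt (i : 'I_120) : G := group_word (icosian_word i).

Lemma elt_inj : injective elt.
Proof.
move=> i j /(congr1 quat); rewrite !quat_group_word -!nth_icosians ?ltn_ord //.
move=> /realize_inj/eqP; rewrite nth_uniq ?size_icosians ?uniq_icosians //.
by move=> /eqP/val_inj.
Qed.

Lemma elt_next b (i : 'I_120) (j : 'I_120) :
  j = next b i :> nat -> elt j = (elt i * letter b)%g.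
Proof.
move=> ji; apply: quat_inj; rewrite quatM !quat_group_word -!nth_icosians ?ltn_ord //.
by rewrite ji nth_next ?ltn_ord // realize_mul_letter quat_letter.
Qed.

Lemma elt_mul_letter b i : exists j, elt j = (elt i * letter b)%g.
Proof.
by exists (Ordinal (next_lt b (ltn_ord i))); apply: elt_next.
Qed.

(** The 120 words are closed under right multiplication by [s] and [t], hence
    by their inverses as [s ^ 6 = t ^ 10 = 1], hence by the group generated. *)
Lemma elt_surj g : exists i, elt i = g.
Proof.
pose H : {pred G} := fun g => `[< forall i, (exists j, elt j = elt i * g)%g
                                   /\ (exists j, elt j = elt i / g)%g >].
have mul_word v i : exists j, elt j = (elt i * group_word v)%g.
  elim/last_ind: v => [|v b [j IH]]; first by exists i; rewrite mulg1.
  have [k ke] := elt_mul_letter b j; exists k.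
  by rewrite ke IH /group_word foldl_rcons mulgA.
have inHT : g \in H.
  apply: generating.
  - split=> [|x y /asboolP Hx /asboolP Hy]; apply/asboolP => i.
      by split; exists i; rewrite ?invg1 mulg1.
    split.
      have [[j je] _] := Hx i; have [_ [k ke]] := Hy j.
      by exists k; rewrite ke je mulgA.
    have [[j je] _] := Hy i; have [_ [k ke]] := Hx j.
    by exists k; rewrite ke je invgF -mulgA.
  - apply/asboolP => i; split; first exact: elt_mul_letter false i.
    have <- : group_word (nseq 5 false) = elt_s^-1%g.
      have power : (group_word (nseq 6 false) = 1)%g.
        exact: (@group_word_eq (nseq 6 false) [::] erefl).
      by rewrite -[elt_s]/(letter false) -(mulg1_eq power) invgK.
    exact: mul_word.
  - apply/asboolP => i; split; first exact: elt_mul_letter true i.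
    have <- : group_word (nseq 9 true) = elt_t^-1%g.
      have power : (group_word (nseq 10 true) = 1)%g.
        exact: (@group_word_eq (nseq 10 true) [::] erefl).
      by rewrite -[elt_t]/(letter true) -(mulg1_eq power) invgK.
    exact: mul_word.
pose i1 : 'I_120 := Ordinal (isT : 0 < 120)%N.
have /asboolP/(_ i1)[[j je] _] := inHT; exists j.
by rewrite je /elt (_ : icosian_word i1 = [::]) // mul1g.
Qed.

(** * Potentials of closed cochains *)
Section Potential.
Variables (A : comNzRingType) (D : zmodClosed A) (w : G -> A * A).
Hypothesis wD : forall x,
  (d1 elt_s elt_t w x).1 \in D /\ (d1 elt_s elt_t w x).2 \in D.

Definition edge_value (b : bool) (g : G) : A := if b then (w g).2 else (w g).1.

Fixpoint integral (g : G) (v : seq bool) : A :=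
  if v is b :: v' then edge_value b g + integral (g * letter b)%g v' else 0.

Lemma integral_rcons g v b :
  integral g (rcons v b)
  = integral g v + edge_value b (foldl (fun h a => h * letter a)%g g v).
Proof.
by elim: v g => [|a v IH] g /=; rewrite ?addr0 ?add0r // IH addrA.
Qed.

Definition vertex (i : nat) : G := group_word (icosian_word i).
(** Integration of [w] along the spanning tree; [defect] measures by how much
    [w] fails to be its coboundary. *)
Definition primitive (i : nat) : A := integral 1%g (icosian_word i).
Definition defect (e : bool * nat) : A :=
  edge_value e.1 (vertex e.2) - (primitive (next e.1 e.2) - primitive e.2).

Lemma vertex_next b i : (i < 120)%N -> vertex (next b i) = (vertex i * letter b)%g.
Proof.
move=> i_lt; exact: (@elt_next b (Ordinal i_lt) (Ordinal (next_lt b i_lt)) erefl).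
Qed.

Lemma sum_defect i v : (i < 120)%N ->
  \sum_(e <- path_edges next i v) defect e
  = integral (vertex i) v - (primitive (walk next i v) - primitive i).
Proof.
elim: v i => [|b v IH] i i_lt; first by rewrite big_nil /= !subrr.
by rewrite big_cons IH ?next_lt // vertex_next //= /defect /walk /=; ring.
Qed.

Lemma tree_defect b i : (i < 120)%N ->
  icosian_word (next b i) = rcons (icosian_word i) b -> defect (b, i) \in D.
Proof.
move=> _ treeE; rewrite /defect /primitive /= treeE integral_rcons.
by rewrite -/(group_word _) -/(vertex i) [X in _ - X]addrC addKr subrr rpred0.
Qed.

(** The two boundary paths of a cell have the same ends, so the contributions
    of [primitive] cancel and the circulation of [w] remains. *)
Lemma cell_defect i r : (i < 120)%N -> r \in relations ->
  \sum_(e <- path_edges next i r.1) defect e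
    - \sum_(e <- path_edges next i r.2) defect e \in D.
Proof.
move=> i_lt rR; rewrite !sum_defect //.
have /allP/(_ i) := icosians_close_up; rewrite mem_iota => /(_ i_lt)/allP/(_ r rR).
move=> /eqP ->.
have cancel_ends (a b k : A) : a - k - (b - k) = a - b by ring.
rewrite cancel_ends.
have [w1 w2] := wD (vertex i); move: rR w1 w2; rewrite /d1 /= !inE.
by case/orP => /eqP -> /= w1 w2; rewrite !addr0 !addrA in w1 w2 *.
Qed.

Lemma edge_defect b i : (i < 120)%N -> defect (b, i) \in D.
Proof.
exact: (saturates_sound tree_defect cell_defect icosians_saturate).
Qed.

Lemma potential_exists : exists f, forall x,
  ((w - d0 elt_s elt_t f) x).1 \in D /\ ((w - d0 elt_s elt_t f) x).2 \in D.
Proof.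
have /choice[idx idxK] := elt_surj.
have idx_next b g : idx (g * letter b)%g = next b (idx g) :> nat.
  pose j := Ordinal (next_lt b (ltn_ord (idx g))).
  have -> : idx (g * letter b)%g = j; last by [].
  by apply: elt_inj; rewrite idxK (@elt_next b (idx g) j) // idxK.
exists (primitive \o idx) => x.
have := (edge_defect false (ltn_ord (idx x)), edge_defect true (ltn_ord (idx x))).
rewrite /defect /= /vertex -/(elt (idx x)) idxK -!idx_next.
by case.
Qed.

End Potential.

End Realization.

Theorem corollary5p3p4 (R : realType) (q : nat) :
  let Hq := cohomology (binary_icosahedral R)
              (trivial_gmodule (binary_icosahedral R) int) q in
  [/\ q = 0%N -> zmod_isomorphic Hq int,
      (0 < q)%N -> q = 0 %[mod 4] -> zmod_isomorphic Hq 'Z_120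
    & ~ (q = 0%N) -> ~ ((0 < q)%N /\ q = 0 %[mod 4]) -> forall x : Hq, x = 0].
Proof.
have /choice[idx idxK] := @elt_surj R.
have eltK : cancel (@elt R) idx.
  by move=> i; apply: (@elt_inj R); exact: (idxK (elt R i)).
have [period vanish] := cohomology_period4 (relation_s R) (relation_t R)
  (@generating R) eltK idxK (@potential_exists R) q isT.
split=> [->|q0 q4|q0 q4]; first exact: cohomology0_trivial.
  by apply: period => //; apply/eqP.
apply: vanish; apply/negP => /eqP q_mod; apply: q4; split=> //.
by rewrite lt0n; apply/eqP.
Qed.
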